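(* For the two-sample problem under known Hölder regularity (known $s > 0$, in dimension $d \ge 1$), there is a constant $c > 0$ depending only on $(s,d,L)$ such that $$R_\varepsilon^{(m,n)}(\mathcal{H}_s^d(L)) \ge \tfrac12, \quad \text{if } \varepsilon \le c\, (m \wedge n)^{-2s/(4s+d)}.$$ Here $R_\varepsilon^{(m,n)}(\mathcal{H}_s^d(L))$ is the minimax risk for testing, from two independent samples of sizes $m$ and $n$ with densities $f$ and $g$ on $[0,1]^d$, the hypothesis $f = g$ against $\|f-g\|_2 \ge \varepsilon$, with $f,g \in \mathcal{H}_s^d(L)$.
   Context: Hölder class: for $s>0$, $\lfloor s \rfloor$ denotes the largest integer strictly smaller than $s$. For a constant $L$, $\mathcal{H}_s^d(L)$ is the class of functions $f:[0,1]^d \to \mathbb{R}$ having a derivative $f^{(\lfloor s\rfloor)}$ of order $\lfloor s \rfloor$ with $|f^{(\lfloor s \rfloor)}(x) - f^{(\lfloor s \rfloor)}(y)| \le L\|x-y\|^{s-\lfloor s\rfloor}$ for all $x,y\in[0,1]^d$, and such that $\|f^{(s')}\|_\infty \le L$ for all $s' \in \{0,\dots,\lfloor s\rfloor\}$. Here $f^{(k)}$ is the derivative of order $k$, with $f^{(0)} = f$. Two-sample problem: $X_1,\dots,X_m$ are i.i.d. with density $f$ and, independently, $Y_1,\dots,Y_n$ are i.i.d. with density $g$, densities being with respect to Lebesgue measure $\nu$ on $[0,1]^d$. A test $\phi$ is a Borel measurable function of the data (both samples) with values in $[0,1]$, giving the probability of rejecting the null hypothesis. $\mathbb{E}_{f,g}^{(m,n)}$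 denotes expectation under this model. Let $\delta(f,g) = \|f-g\|_2 = (\int (f-g)^2\,d\nu)^{1/2}$. For a class $\mathcal{H}$ of functions and $\varepsilon > 0$, the worst-case risk of $\phi$ is $$R_\varepsilon^{(m,n)}(\phi;\mathcal{H}) = \sup\{\mathbb{E}^{(m,n)}_{f,f}[\phi] : f \in \mathcal{H}\} + \sup\{\mathbb{E}^{(m,n)}_{f,g}[1-\phi] : f,g \in \mathcal{H},\ \delta(f,g) \ge \varepsilon\},$$ where $f,g$ are understood to be probability densities. The minimax risk is $R_\varepsilon^{(m,n)}(\mathcal{H}) = \inf_\phi R_\varepsilon^{(m,n)}(\phi;\mathcal{H})$, the infimum being over all tests. $m\wedge n = \min(m,n)$.
   Formalization: The constant L is assumed to satisfy L > 1; for L ≤ 1 the Hölder class contains at most the uniform density, so the alternative is empty, the test φ = 0 has risk below 1/2, and the claim fails. *)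

(* Defs.v *)
From HB Require Import structures.
From mathcomp Require Import all_boot all_order all_algebra.
From mathcomp Require Import all_classical all_reals all_analysis.
From mathcomp Require Import measurable_realfun.

Set Implicit Arguments.
Unset Strict Implicit.
Unset Printing Implicit Defensive.

Import Order.TTheory GRing.Theory Num.Theory.
Import numFieldNormedType.Exports.

Local Open Scope classical_set_scope.
Local Open Scope ring_scope.

Section hoelder_class.
Context {R : realType}.

(* For 0 < s, the largest integer strictly smaller than s (so s - 1, and not s,
   when s is an integer); see [sfloorP]. *)
Definition sfloor (s : R) : nat := `|Num.ceil s|%N.-1.

Lemma sfloorP (s : R) : 0 < s -> (sfloor s)%:R < s <= (sfloor s).+1%:R.
Proof.
move=> s0; rewrite /sfloor; have := ceil_itv s; have := s0; rewrite -ceil_gt0.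
case: (Num.ceil s) => // -[//|n] _.
by rewrite intS addrAC subrr add0r -intS.
Qed.

Definition enorm {d : nat} (x : 'rV[R]_d) : R :=
  Num.sqrt (\sum_(i < d) x 0 i ^+ 2).

Definition cube (d : nat) : set 'rV[R]_d :=
  [set x | forall i, 0 <= x 0 i <= 1].
Arguments cube : clear implicits.

(* [cube_deriv f [:: v1; ...; vk] x] is the k-linear form f^(k)(x) evaluated at
   (v1, ..., vk). Differentials are taken along the neighborhoods of x within
   the cube: they only depend on the values of f on the cube, and are one-sided
   at its boundary. *)
Fixpoint cube_deriv {d : nat} (f : 'rV[R]_d -> R) (vs : seq 'rV[R]_d) :
    'rV[R]_d -> R :=
  if vs is v :: vs' then
    fun x => 'd (cube_deriv f vs' : 'rV[R]_d -> R^o) (within (cube d) (nbhs x)) v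
  else f.

(* A bound on all the values at families [vs] of vectors of the Euclidean unit
   ball is a bound on the operator norm of a multilinear form. *)
Definition hoelder_class (s : R) (d : nat) (L : R) : set ('rV[R]_d -> R) :=
  [set f |
    [/\ forall vs x, (size vs < sfloor s)%N -> cube d x ->
          differentiable (cube_deriv f vs : 'rV[R]_d -> R^o)
            (within (cube d) (nbhs x)),
        forall vs x y, size vs = sfloor s -> all (fun v => enorm v <= 1) vs ->
          cube d x -> cube d y ->
          `|cube_deriv f vs x - cube_deriv f vs y|
            <= L * enorm (x - y) `^ (s - (sfloor s)%:R)
      & forall vs x, (size vs <= sfloor s)%N ->
          all (fun v => enorm v <= 1) vs -> cube d x ->
          `|cube_deriv f vs x| <= L ] ].

End hoelder_class.
Arguments cube {R} d.
Arguments hoelder_class {R} s d L.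

Section product_power.
Context {disp : measure_display} {T : measurableType disp} {R : realType}.

Definition tcons (n : nat) (z : T * n.-tuple T) : n.+1.-tuple T :=
  [the n.+1.-tuple T of z.1 :: z.2].

Lemma measurable_tcons (n : nat) : measurable_fun setT (@tcons n).
Proof. exact: measurable_cons. Qed.

HB.instance Definition _ (n : nat) :=
  @isMeasurableFun.Build _ _ _ _ (@tcons n) (@measurable_tcons n).

(* The n-fold product of P, on the product sigma-algebra of T^n. *)
Fixpoint prob_pow (P : probability T R) (n : nat) :
    probability (n.-tuple T) R :=
  if n is n'.+1 then
    distribution ((P \x prob_pow P n')%E) (@tcons n')
  else \d_ [tuple].

Lemma prob_pow_box (P : probability T R) (n : nat) (A : 'I_n -> set T) :
  (forall i, measurable (A i)) ->
  prob_pow P n [set t | forall i, A i (tnth t i)] = (\prod_(i < n) P (A i))%E.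
Proof.
elim: n A => [|n IH] A mA /=.
  by rewrite big_ord0 diracE mem_set// => -[].
rewrite big_ord_recl /= /distribution /pushforward.
have mB : measurable [set t : n.-tuple T | forall i, A (lift ord0 i) (tnth t i)].
  rewrite (_ : mkset _ = \bigcap_(i in [set: 'I_n])
      ((fun t : n.-tuple T => tnth t i) @^-1` A (lift ord0 i))).
    apply: fin_bigcap_measurable => // i _.
    by rewrite -[X in measurable X]setTI; exact: measurable_tnth.
  by apply/seteqP; split => t /= At; [move=> i _; exact: At|move=> i; exact: At].
rewrite -(IH (fun i => A (lift ord0 i)))// -product_measure1E//.
congr (_ _); apply/seteqP; split => -[x t] /=.
  by move=> At; split=> [|i]; [exact: (At ord0)|have := At (lift ord0 i); rewrite tnthS].
move=> [Ax At] i; case: (unliftP ord0 i) => [j ->|->//].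
by rewrite tnthS; exact: At.
Qed.

End product_power.

Section two_sample.
Context {R : realType}.

Definition unit_lebesgue : set (measurableTypeR R) -> \bar R :=
  mrestr lebesgue_measure (measurable_itv `[0:R, 1]).

HB.instance Definition _ := Measure.on unit_lebesgue.

Lemma unit_lebesgue_setT : unit_lebesgue setT = 1%E.
Proof.
by rewrite /unit_lebesgue /mrestr setTI lebesgue_measure_itv/= lte01 oppr0 adde0.
Qed.

HB.instance Definition _ :=
  Measure_isProbability.Build _ _ _ unit_lebesgue unit_lebesgue_setT.

(* The space of observations is R^d with its Borel sigma-algebra; tuples carry
   the measurable structure and row vectors the normed one. *)
Definition obs (d : nat) := d.-tuple (measurableTypeR R).

Definition row_of_obs {d : nat} (t : obs d) : 'rV[R]_d := \row_i tnth t i.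

Definition obs_cube (d : nat) : set (obs d) := row_of_obs @^-1` cube d.
Arguments obs_cube : clear implicits.

(* Lebesgue measure on [0, 1]^d, as a measure on R^d carried by the cube. *)
Definition cube_lebesgue (d : nat) : probability (obs d) R :=
  prob_pow unit_lebesgue d.

Record density (d : nat) := Density {
  density_fun :> 'rV[R]_d -> R ;
  density_measurable : measurable_fun (obs_cube d) (density_fun \o row_of_obs) ;
  density_ge0 : forall x, cube d x -> 0 <= density_fun x ;
  density_integral1 :
    (\int[cube_lebesgue d]_(t in obs_cube d) (density_fun (row_of_obs t))%:E
      = 1)%E }.

Section law.
Context {d : nat} (f : density d).

Definition law (A : set (obs d)) : \bar R :=
  (\int[cube_lebesgue d]_(t in A `&` obs_cube d)
     (density_fun f (row_of_obs t))%:E)%E.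

Lemma measurable_obs_cube : measurable (obs_cube d).
Proof.
rewrite (_ : obs_cube d = \bigcap_(i in [set: 'I_d])
    ((fun t : obs d => tnth t i) @^-1` [set` `[0:R, 1]])).
  apply: fin_bigcap_measurable => // i _.
  by rewrite -[X in measurable X]setTI; apply: measurable_tnth.
apply/seteqP; split => t /= At; last first.
  by move=> i; have := At i I; rewrite /= in_itv/= mxE.
by move=> i _; have := At i; rewrite /= in_itv/= mxE.
Qed.

Let law0 : law set0 = 0%E.
Proof. by rewrite /law set0I integral_set0. Qed.

Let law_ge0 A : (0 <= law A)%E.
Proof.
by apply: integral_ge0 => t [_ ct]; rewrite lee_fin; exact: density_ge0.
Qed.

Let law_sigma_additive : semi_sigma_additive law.
Proof.
move=> F mF tF mUF; rewrite /law; apply: cvg_toP.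
  apply: ereal_nondecreasing_is_cvgn => m n mn.
  by apply: lee_sum_nneg_natr => // k _ _; exact: law_ge0.
rewrite setI_bigcupl ge0_integral_bigcup//=.
- by move=> k; apply: measurableI => //; exact: measurable_obs_cube.
- apply/measurable_EFinP; apply: measurable_funS (density_measurable f).
    exact: measurable_obs_cube.
  by move=> t [k _ []].
- by move=> t [k _ [_ ct]]; rewrite lee_fin; exact: density_ge0.
- exact: trivIset_setIr.
Qed.

HB.instance Definition _ :=
  isMeasure.Build _ _ _ law law0 law_ge0 law_sigma_additive.

Lemma law_setT : law setT = 1%E.
Proof. by rewrite /law setTI; exact: density_integral1. Qed.

HB.instance Definition _ := Measure_isProbability.Build _ _ _ law law_setT.

End law.

Definition data (m n d : nat) : Type := (m.-tuple (obs d) * n.-tuple (obs d))%type.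

(* Values of a test outside the cube are irrelevant, as the data lie in it
   almost surely. *)
Definition tests (m n d : nat) : set (data m n d -> R) :=
  [set phi : data m n d -> R |
    measurable_fun setT phi /\ forall z, 0 <= phi z <= 1].
Arguments tests : clear implicits.

Definition two_sample_expectation (m n d : nat) (f g : density d)
    (phi : data m n d -> R) : \bar R :=
  ('E_(prob_pow (law f) m \x prob_pow (law g) n)[phi])%E.

Definition L2dist {d : nat} (f g : density d) : \bar R :=
  ('N[cube_lebesgue d]_(2%:E)
    [(fun t => (f (row_of_obs t) - g (row_of_obs t))%R%:E) \_ (obs_cube d)])%E.

Definition risk (m n d : nat) (H : set ('rV[R]_d -> R)) (eps : R)
    (phi : data m n d -> R) : \bar R :=
  (ereal_sup [set two_sample_expectation f f phi | f in [set f : density d | H f]]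
   + ereal_sup [set two_sample_expectation fg.1 fg.2 (fun z => 1 - phi z)%R
       | fg in [set fg : density d * density d |
                 [/\ H fg.1, H fg.2 & eps%:E <= L2dist fg.1 fg.2]] ])%E.

Definition minimax_risk (m n d : nat) (H : set ('rV[R]_d -> R)) (eps : R) :
    \bar R :=
  ereal_inf [set risk H eps phi | phi in tests m n d].

End two_sample.
Arguments obs_cube {R} d.
Arguments cube_lebesgue {R} d.
Arguments tests {R} m n d.
Arguments minimax_risk {R} m n {d} H eps.

(* Main.v *)
From HB Require Import structures.
Require Import Defs.
From mathcomp Require Import all_boot all_order all_algebra.
From mathcomp Require Import all_classical all_reals all_analysis.
From mathcomp Require Import measurable_realfun ring lra zify.

Import Order.TTheory GRing.Theory Num.Theory.
Import numFieldNormedType.Exports.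

Set Implicit Arguments.
Unset Strict Implicit.
Unset Printing Implicit Defensive.

Local Open Scope classical_set_scope.
Local Open Scope ring_scope.

(** The lower bound is Ingster's second-moment argument. Let [N] be the smaller
sample size. Both samples are uniform under the null, while under the
alternative the smaller sample has a density [1 + rho * sum_j eta_j phi_j] and
the other one is still uniform. Here [j] ranges over the [kappa ^ d] cells of a
regular grid of mesh [1 / kappa], [phi_j] is a copy in the cell [j] of a fixed
bump of mean zero, and the signs [eta_j] are independent and uniform.

These functions have disjoint supports, so their sum has the size of a single
one. Differentiating [l] times multiplies by [kappa ^ l], hence the amplitude
[rho = c0 * kappa `^ - s] keeps all the densities in the Hoelder ball
([hoelder_class_perturbed]). They are also orthogonal, with squared norms of
order [kappa ^- d], so each density is at distance of order [rho] from the
uniform one ([perturbed_distance]).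

A test that distinguishes the null from every alternative distinguishes it from
their mixture. If [Z] is the likelihood ratio of the mixture, the sum of the two
errors of a test [phi] is the integral under the null of
[phi + Z * (1 - phi) >= 3 / 4 - (Z - 1) ^ 2], which is at least [1 / 2] as soon
as the integral of [Z ^ 2] is at most [5 / 4] ([exists_large_error] and
[minimax_risk_ge]). That second moment is an average over two independent sign
vectors of [(1 + rho ^ 2 * sum_j eta_j eta'_j ||phi_j|| ^ 2) ^ N]; bounding
[1 + u] by [expR u], the average factorizes over the cells, and it is at most
[1 / (1 - N ^ 2 rho ^ 4 kappa ^- d)] ([chi2_mixture]). The
choice of [kappa] of order [N `^ (2 / (4 s + d))] makes [N ^ 2 rho ^ 4 kappa ^- d]
at most [c0 ^ 4], while [rho] is of order [N `^ (- 2 s / (4 s + d))], the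
announced rate ([exists_bandwidth]). *)

(** * A smooth bump on the line *)

Section bump.
Context {R : realType}.
Implicit Types (x y : R) (K n a k : nat).

(** Away from [0] the function agrees locally with a monomial or with zero. At
[0] the difference quotient in [h != 0] is exactly [Num.max h 0 ^+ n.+1]. *)
Lemma is_derive_pospart_pow n y :
  is_derive y 1 (fun z : R => Num.max z 0 ^+ n.+2)
    (n.+2%:R * Num.max y 0 ^+ n.+1).
Proof.
have dX (z : R) : is_derive z 1 (fun z : R => z ^+ n.+2) (n.+2%:R * z ^+ n.+1).
  have := is_derive_poly 'X^(n.+2) z; rewrite derivXn hornerMn hornerXn mulr_natl.
  by rewrite (_ : horner _ = fun z => z ^+ n.+2)//; apply/funext => t; rewrite hornerXn.
have [y0|y0|->] := ltgtP y 0.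
- rewrite expr0n/= mulr0; apply: (@near_eq_is_derive _ _ _ (cst 0)).
  by near=> z; rewrite max_r ?expr0n//= ltW//; near: z; exact: lt_nbhsl.
- apply: (@near_eq_is_derive _ _ _ (fun z : R => z ^+ n.+2)) (dX y).
  by near=> z; rewrite max_l// ltW//; near: z; exact: lt_nbhsr.
- rewrite expr0n mulr0.
  suff h : (fun h : R => h^-1 *: (Num.max (h * 1 + 0) 0 ^+ n.+2 - Num.max 0 0 ^+ n.+2)) @ 0^' --> (0 : R).
    split; first by apply/cvg_ex; exists 0; exact: h.
    by apply: cvg_lim h; exact: norm_hausdorff.
  have cm : (fun h : R => Num.max h 0 ^+ n.+1) @ 0^' --> (0 : R).
    have : continuous ((fun h => h ^+ n.+1) \o (fun h : R => Num.max h 0)).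
      move=> x; apply: continuous_comp; last exact: exprn_continuous.
      by apply: continuous_max; [exact: cvg_id|exact: cvg_cst].
    move=> /(_ 0); rewrite /continuous_at/= maxxx expr0n => c.
    exact: cvg_within_filter.
  apply: cvg_trans cm; apply: near_eq_cvg; near=> h.
  have h0 : h != 0 by near: h; exact: nbhs_dnbhs_neq.
  rewrite maxxx expr0n subr0 /GRing.scale/= mulr1 addr0.
  have [h1|h1] := leP h 0; first by rewrite !expr0n mulr0.
  by rewrite [in RHS]exprS mulKf.
Unshelve. all: by end_near. Qed.

Definition well x : R := Num.max (x * (1 - x)) 0.

Lemma is_derive_well_pow n x :
  is_derive x 1 (fun z => well z ^+ n.+2)
    (n.+2%:R * well x ^+ n.+1 * (1 - 2 * x)).
Proof.
have dw : is_derive x 1 (fun z : R => z * (1 - z)) (1 - 2 * x).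
  by apply: is_derive_eq; rewrite /GRing.scale/=; ring.
exact: (@is_derive1_comp _ (fun z => Num.max z 0 ^+ n.+2) (fun z => z * (1 - z))
  x _ _ (is_derive_pospart_pow n _) dw).
Qed.

Lemma well_out x : ~~ (0 < x < 1) -> well x = 0.
Proof.
move=> xo; apply/max_idPr; move: xo; rewrite negb_and -!leNgt => /orP[]; nra.
Qed.

Lemma well01 x : 0 <= well x <= 1.
Proof.
rewrite /well le_max lexx orbT/= ge_max ler01 andbT.
by have := sqr_ge0 (x - 2^-1); nra.
Qed.

(** Since [well z ^+ n.+2 = z * (1 - z) * well z ^+ n.+1], a derivative of
[r * well ^+ n.+2], for a polynomial [r], is again a polynomial times the power
[n.+1] of [well]; this is the recursion that these polynomials satisfy. *)
Fixpoint bump_coef K a : {poly R} :=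
  if a is a'.+1 then
    (bump_coef K a')^`() * ('X * (1 - 'X))
      + (K - a')%:R *: (bump_coef K a' * (1 - 2%:P * 'X))
  else 1 - 2%:P * 'X.

(** For [a < K], the derivative of order [a] of [(1 - 2 x) (x (1 - x)) ^ K],
extended by zero outside of the unit interval. The factor [1 - 2 x] makes the
integral vanish. *)
Definition bump K a x : R := (bump_coef K a).[x] * well x ^+ (K - a).

Lemma is_derive_bump K a x : (a.+2 <= K)%N ->
  is_derive x 1 (bump K a) (bump K a.+1 x).
Proof.
move=> aK; rewrite /bump; have [n Kn] : exists n, (K - a = n.+2)%N.
  by exists (K - a.+2)%N; lia.
rewrite (_ : K - a.+1 = n.+1)%N; last by lia.
rewrite Kn.
apply: is_derive_eq (is_deriveM (is_derive_poly _ x) (is_derive_well_pow n x)) _.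
rewrite /GRing.scale/= !hornerE Kn.
have wE : well x ^+ n.+2 = (x * (1 - x)) * well x ^+ n.+1.
  rewrite exprS; have [->|w0] := eqVneq (well x) 0; first by rewrite !exprS !mul0r mulr0.
  by congr (_ * _); move: w0; rewrite /well; case: leP => //; rewrite eqxx.
rewrite wE /=; ring.
Qed.

Lemma bump_out K a x : (a < K)%N -> ~~ (0 < x < 1) -> bump K a x = 0.
Proof.
by move=> aK xo; rewrite /bump well_out// expr0n subn_eq0 leqNgt aK mulr0.
Qed.

Lemma bump_bounded K a : (a < K)%N -> exists2 M, 0 <= M & forall x, `|bump K a x| <= M.
Proof.
move=> aK; exists (\sum_(i < size (bump_coef K a)) `|(bump_coef K a)`_i|).
  by apply: sumr_ge0.
move=> x; have [/andP[x0 x1]|/(bump_out aK)->] := boolP (0 < x < 1); last first.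
  by rewrite normr0 sumr_ge0.
rewrite /bump normrM -[leRHS]mulr1 ler_pM//.
  rewrite horner_coef (le_trans (ler_norm_sum _ _ _))// ler_sum// => i _.
  by rewrite normrM -[leRHS]mulr1 ler_wpM2l// normrX exprn_ile1// ger0_norm ltW.
by have /andP[w0 w1] := well01 x; rewrite normrX exprn_ile1// ger0_norm.
Qed.

Lemma bump0_le1 K x : (0 < K)%N -> `|bump K 0 x| <= 1.
Proof.
move=> K0; have [/andP[x0 x1]|/(bump_out K0)->] := boolP (0 < x < 1); last first.
  by rewrite normr0.
rewrite /bump normrM -[leRHS]mulr1 ler_pM//.
  by rewrite !hornerE ler_norml; lra.
by have /andP[w0 w1] := well01 x; rewrite normrX exprn_ile1// ger0_norm.
Qed.

(** A lower bound on a fixed part of the unit interval is all that the squared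
norm of the bump needs. *)
Lemma bump0_ge K x : 8^-1 <= x <= 4^-1 -> (2^-1 * (7 / 64) ^+ K) ^+ 2 <= bump K 0 x ^+ 2.
Proof.
move=> x14; rewrite ler_sqr ?nnegrE; last 2 first.
- by rewrite mulr_ge0// exprn_ge0.
- rewrite /bump !hornerE mulr_ge0//; first by lra.
  by rewrite exprn_ge0//; have /andP[] := well01 x.
rewrite /bump subn0 ler_pM// ?exprn_ge0//.
- by rewrite !hornerE; lra.
- by rewrite lerXn2r ?nnegrE//; [have /andP[] := well01 x|rewrite /well le_max; apply/orP; left; nra].
Qed.

Lemma continuous_bump0 K : (1 < K)%N -> continuous (bump K 0).
Proof.
move=> K1 x; apply/differentiable_continuous/derivable1_diffP.
by have [] := is_derive_bump x K1.
Qed.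

(** This primitive vanishes at both ends of the unit interval, hence the bump
has mean zero. *)
Lemma is_derive_bump_primitive K x :
  is_derive x 1 (fun z => K.+2%:R^-1 * well z ^+ K.+2) (bump K.+1 0 x).
Proof.
have -> : (fun z => K.+2%:R^-1 * well z ^+ K.+2) = K.+2%:R^-1 *: (fun z => well z ^+ K.+2) by [].
apply: is_derive_eq (is_deriveZ _ (is_derive_well_pow K x)) _.
rewrite /GRing.scale/= /bump !hornerE /= subn0 -mulrA mulVf ?pnatr_eq0// mul1r.
exact: mulrC.
Qed.

End bump.

(** * Hoelder bounds from explicit partial derivatives *)

Section tower.
Context {R : realType} {d : nat}.
Implicit Types (f : 'rV[R]_d -> R) (x y v : 'rV[R]_d).

Definition lincomb (g : 'I_d -> R) (v : 'rV[R]_d) : R := \sum_i v 0 i * g i.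

Definition has_gradient f x (g : 'I_d -> R) :=
  is_diff x (f : 'rV[R]_d -> R^o) (lincomb g : 'rV[R]_d -> R^o).

Let lincomb_linear g : linear (lincomb g : 'rV[R]_d -> R^o).
Proof.
move=> a u v; rewrite /lincomb scaler_sumr -big_split/=; apply: eq_bigr => i _.
by rewrite !mxE mulrDl -mulrA.
Qed.

Let lincomb_lin (g : 'I_d -> R) : {linear 'rV[R]_d -> R^o} :=
  HB.pack (lincomb g : 'rV[R]_d -> R^o)
    (GRing.isLinear.Build _ _ _ _ _ (lincomb_linear g)).

Lemma within_cube_proper x : cube d x -> ProperFilter (within (cube d) (nbhs x)).
Proof.
by move=> cx; apply: within_nbhs_proper => A /nbhs_singleton Ax; exists x.
Qed.

Lemma cube_segment x y (t : R) : cube d x -> cube d y -> 0 <= t <= 1 ->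
  cube d (x + t *: (y - x)).
Proof.
move=> cx cy /andP[t0 t1] i; have := cx i; have := cy i; rewrite !mxE.
move=> /andP[y0 y1] /andP[x0 x1]; nra.
Qed.

(** Differentials relative to the cube are unique: by convexity [x] sees every
point [y] of the cube along a segment, so that [A (y - x) = 0] by scaling, and
the vectors [y - x] span the space, since the cube contains [0] and the
canonical basis. *)
Lemma linear_cube0 (A : {linear 'rV[R]_d -> R^o}) x : cube d x ->
  (forall e : R, 0 < e ->
     \forall y \near within (cube d) (nbhs x), `|A (y - x)| <= e * `|y - x|) ->
  forall v, A v = 0.
Proof.
move=> cx oA.
have A0 y : cube d y -> A (y - x) = 0.
  move=> cy; apply/eqP; rewrite -normr_le0; apply/ler_addgt0Pr => e e0.
  rewrite add0r.
  pose e' := e / (1 + `|y - x|).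
  have y1 : 0 < 1 + `|y - x| by rewrite ltr_pwDl.
  have e'0 : 0 < e' by rewrite divr_gt0.
  have := oA _ e'0; rewrite near_withinE => -/nbhs_ballP[r /= r0 rx].
  pose t := Num.min 1 (r / 2 / (1 + `|y - x|)).
  have t0 : 0 < t by rewrite /t lt_min ltr01/= !divr_gt0.
  have t1 : t <= 1 by rewrite /t ge_min lexx.
  have tr : t * `|y - x| < r.
    have : t * (1 + `|y - x|) <= r / 2 by rewrite -ler_pdivlMr// /t ge_min lexx orbT.
    by rewrite mulrDr mulr1 => h; lra.
  have := rx (x + t *: (y - x)).
  rewrite -ball_normE /= opprD addrA subrr sub0r normrN normrZ gtr0_norm//.
  move=> /(_ tr (cube_segment cx cy _)); rewrite (ltW t0) t1 => /(_ isT).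
  rewrite addrAC subrr add0r linearZ normrZ normrZ (gtr0_norm t0).
  rewrite mulrCA ler_pM2l// => /le_trans; apply.
  rewrite /e' mulrAC ler_pdivrMr// ler_pM2l//; lra.
have Ae i : A (delta_mx 0 i) = 0.
  have c0 : cube d (0 : 'rV[R]_d) by move=> j; rewrite mxE lexx ler01.
  have ci : cube d (delta_mx 0 i : 'rV[R]_d).
    by move=> j; rewrite mxE eqxx/=; case: eqP => _ /=; rewrite ?lexx ler01.
  rewrite (_ : delta_mx 0 i = (delta_mx 0 i - x) - (0 - x)); last first.
    by rewrite sub0r opprK subrK.
  by rewrite linearB/= !A0// subr0.
move=> v; rewrite (row_sum_delta v) linear_sum big1// => i _.
by rewrite linearZ/= Ae scaler0.
Qed.

(** A gradient on the whole space is also the differential along the cube. The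
function [h] need only agree with [f] on the cube, which is what an induction on
the order of the derivative needs: an iterated [cube_deriv] is only known
there. *)
Lemma diff_within_cube f h x g : {in cube d, f =1 h} -> cube d x ->
  has_gradient h x g ->
  differentiable (f : 'rV[R]_d -> R^o) (within (cube d) (nbhs x)) /\
  forall v, 'd (f : 'rV[R]_d -> R^o) (within (cube d) (nbhs x)) v = lincomb g v.
Proof.
move=> fh cx [df dfE].
pose F := within (cube d) (nbhs x).
have PF : ProperFilter F := within_cube_proper cx.
have limx : lim F = x.
  apply: (@cvg_lim _ (@norm_hausdorff _ _) _ F PF id).
  exact: cvg_within.
have cg : continuous (lincomb g : 'rV[R]_d -> R^o).
  by rewrite -dfE; exact: diff_continuous.
have fo : forall e : R, 0 < e -> \forall y \near F,
    `|f y - (f x + lincomb g (y - x))| <= e * `|y - x|.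
  move=> e e0.
  have /diffP[_ h0] := df.
  have hD y : h y = h x + lincomb g (y - x) +o_(y \near nbhs x) (y - x).
    by have := h0 y; rewrite (lim_id (@norm_hausdorff _ _)) dfE.
  pose G := nbhs x.
  have /eqaddoP/(_ e e0) : (h : 'rV[R]_d -> R^o) = (fun y => h x + lincomb g (y - x)) +o_G (fun y => y - x).
    by apply/funext => y; rewrite [LHS]hD.
  move=> hG; rewrite near_withinE; near=> y => cy.
  by rewrite !fh ?inE//; near: y.
have ex : exists D : {linear 'rV[R]_d -> R^o}, continuous D /\ forall y,
  (f y : R^o) = f (lim F) + D (y - lim F)
    +o_(y \near F) (y - lim F).
  exists (lincomb_lin g); split; first exact: cg.
  rewrite limx => y.
  have fo'  : (f : 'rV[R]_d -> R^o) = (fun y => f x + lincomb_lin g (y - x)) +o_F (fun y => y - x).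
    by apply/eqaddoP => e e0; exact: fo.
  by rewrite [in LHS]fo'.
pose D : {linear 'rV[R]_d -> R^o} := 'd (f : 'rV[R]_d -> R^o) F.
have [cD fD] : continuous D /\ forall y,
  (f y : R^o) = f (lim F) + D (y - lim F) +o_(y \near F) (y - lim F) := getPex ex.
have dE : forall v, 'd (f : 'rV[R]_d -> R^o) F v = lincomb g v.
  move=> v; apply/eqP; rewrite -subr_eq0; apply/eqP.
  have Do : forall e : R, 0 < e -> \forall y \near F,
      `|f y - (f x + D (y - x))| <= e * `|y - x|.
    move=> e e0.
    have /eqaddoP/(_ e e0) : (f : 'rV[R]_d -> R^o) = (fun y => f x + D (y - x)) +o_F (fun y => y - x).
      by apply/funext => y; rewrite [LHS]fD limx.
    by [].
  apply: (@linear_cube0 (D \- lincomb_lin g) x cx) => e e0.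
  near=> y.
  have subE (a b c z : R) : b - c = (z - (a + c)) - (z - (a + b)) by ring.
  rewrite /= [X in `|X|](subE (f x) _ _ (f y)).
  rewrite (le_trans (ler_normB _ _))// [e in e * _](splitr e) mulrDl lerD//.
    by near: y; apply: fo; rewrite divr_gt0.
  by near: y; apply: Do; rewrite divr_gt0.
by split=> //; apply/diffP; split; [exact: cD|move=> y; exact: fD].
Unshelve. all: by end_near. Qed.

(** The bounds start at order [1], so that adding a constant to [f] preserves the
property. The gradients are those of functions on the whole space, where the
rules of differential calculus apply; [diff_within_cube] relates them to the
differentials along the cube. *)
Fixpoint hoelder_tower (a : R) (k : nat) (B : R) f : Prop :=
  if k is k'.+1 then
    exists g : 'I_d -> 'rV[R]_d -> R,
      (forall x, cube d x -> has_gradient f x (g ^~ x)) /\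
      forall i, (forall x, cube d x -> `|g i x| <= B) /\
        hoelder_tower a k' B (g i)
  else forall x y, cube d x -> cube d y -> `|f x - f y| <= B * enorm (x - y) `^ a.

Definition l1norm v : R := \sum_i `|v 0 i|.

Lemma has_gradient_sum (I : finType) (c : I -> R) (h : I -> 'rV[R]_d -> R) x
    (g : I -> 'I_d -> R) :
  (forall i, has_gradient (h i) x (g i)) ->
  has_gradient (fun y => \sum_i c i * h i y) x (fun j => \sum_i c i * g i j).
Proof.
move=> hg.
have : is_diff x (\sum_i c i *: (h i : 'rV[R]_d -> R^o)) (\sum_i c i *: (lincomb (g i) : 'rV[R]_d -> R^o)).
  elim/big_ind2 : _ => //.
  - exact: (is_diff_cst (0 : R^o) x).
  - by move=> *; exact: is_diffD.
  - by move=> i _; apply: is_diffZ; exact: hg.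
rewrite /has_gradient; congr (is_diff _ _ _); apply/funext => y.
  by rewrite fct_sumE.
rewrite fct_sumE /lincomb.
under eq_bigr do rewrite scalrfctE scaler_sumr.
rewrite exchange_big; apply: eq_bigr => j _; rewrite mulr_sumr.
by apply: eq_bigr => i _; rewrite mulrCA.
Qed.

Lemma lincomb_bound (v : 'rV[R]_d) (B : R) (h : 'I_d -> R) :
  (forall i, `|h i| <= B) -> `|\sum_i v 0 i * h i| <= l1norm v * B.
Proof.
move=> hB; rewrite (le_trans (ler_norm_sum _ _ _))// /l1norm mulr_suml.
by apply: ler_sum => i _; rewrite normrM ler_wpM2l.
Qed.

Lemma hoelder_tower_lincomb a k B (h : 'I_d -> 'rV[R]_d -> R) v :
  (forall i, hoelder_tower a k B (h i)) ->
  hoelder_tower a k (l1norm v * B) (fun x => \sum_i v 0 i * h i x).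
Proof.
elim: k h => [|k IH] h hT /=.
  move=> x y cx cy; rewrite -sumrB.
  under eq_bigr do rewrite -mulrBr.
  rewrite (le_trans (lincomb_bound _ (fun i => hT i x y cx cy)))//.
  by rewrite mulrA.
have /choice[g gP] := hT.
exists (fun j x => \sum_i v 0 i * g i j x); split.
  by move=> x cx; apply: has_gradient_sum => i; exact: (gP i).1.
move=> j; split.
  by move=> x cx; apply: lincomb_bound => i; exact: ((gP i).2 j).1.
by apply: IH => i; exact: ((gP i).2 j).2.
Qed.

(** Each differentiation replaces the function by a linear combination of its
partial derivatives, which costs a factor [l1norm v] in the bounds. The iterated
derivative is replaced by a function [h] with the same values on the cube and
with gradients in the whole space. *)
Lemma hoelder_tower_deriv a k B f vs : hoelder_tower a (size vs + k) B f ->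
  exists h, hoelder_tower a k ((\prod_(v <- vs) l1norm v) * B) h /\
    {in cube d, cube_deriv f vs =1 h}.
Proof.
elim: vs k => [|v vs IH] k; first by rewrite big_nil mul1r => fT; exists f.
rewrite [size _]/= addSnnS => /IH[h [[g [gd gT]] fh]].
exists (fun x => \sum_i v 0 i * g i x); split.
  by rewrite big_cons -mulrA; apply: hoelder_tower_lincomb => i; exact: (gT i).2.
move=> x /[!inE] cx.
exact: (diff_within_cube fh cx (gd x cx)).2.
Qed.

Lemma l1norm_le v : l1norm v <= d%:R * enorm v.
Proof.
rewrite mulr_natl -[X in _ *+ X]card_ord -sumr_const.
apply: ler_sum => i _; rewrite -sqrtr_sqr ler_wsqrtr//.
by rewrite (bigD1 i)//= lerDl sumr_ge0// => j _; exact: sqr_ge0.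
Qed.

Lemma hoelder_tower_addc a k B c f :
  hoelder_tower a k B f -> hoelder_tower a k B (fun x => c + f x).
Proof.
case: k => [|k]/=.
  by move=> fH x y cx cy; rewrite opprD addrACA subrr add0r; exact: fH.
move=> [g [gd gT]]; exists g; split=> // x cx.
have := is_diffD (is_diff_cst (c : R^o) x) (gd x cx).
by rewrite add0r.
Qed.

(** The mean value theorem along the segment from [y] to [x]. *)
Lemma has_gradient_lipschitz f (g : 'I_d -> 'rV[R]_d -> R) B :
  (forall x, has_gradient f x (g ^~ x)) -> (forall i x, `|g i x| <= B) ->
  forall x y, `|f x - f y| <= l1norm (x - y) * B.
Proof.
move=> fg gB x y.
pose p (t : R) := y + t *: (x - y).
have dp (t : R) : is_derive t 1 (f \o p) (lincomb (g ^~ (p t)) (x - y)).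
  have h1 : is_diff t (p : R^o -> 'rV[R]_d) ( *:%R ^~ (x - y)).
    have := is_diffD (is_diff_cst y t) (is_diff_scalel t (x - y)).
    by rewrite add0r.
  have h2 := is_diff_comp h1 (fg (p t)).
  have [h3 h4] := h2.
  split; first exact: diff_derivable.
  by rewrite deriveE// h4/= scale1r.
have c : {within `[0 : R, 1], continuous (f \o p)}.
  apply: continuous_subspaceT => t.
  apply/differentiable_continuous/derivable1_diffP.
  by have [] := dp t.
have [t _] := MVT_segment ler01 (fun t _ => dp t) c.
rewrite /p/= subr0 mulr1 scale1r scale0r addr0 [y + _]addrC subrK => ->.
by rewrite lincomb_bound.
Qed.

(** Unit vectors have [l1norm] at most [d], so [d ^+ sfloor s] bounds the factors
lost in passing from partial derivatives to multilinear forms. *)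
Lemma hoelder_class_tower s L B f : 0 <= B -> d%:R ^+ (sfloor s) * B <= L ->
  (0 < d)%N ->
  (forall x, cube d x -> `|f x| <= L) ->
  hoelder_tower (s - (sfloor s)%:R) (sfloor s) B f -> hoelder_class s d L f.
Proof.
move=> B0 BL d0 fL fT.
have prodB (vs : seq 'rV[R]_d) : (size vs <= sfloor s)%N ->
    all (fun v => enorm v <= 1) vs -> (\prod_(v <- vs) l1norm v) * B <= L.
  move=> vss /allP vs1; apply: le_trans BL; rewrite ler_wpM2r//.
  apply: (@le_trans _ _ (\prod_(v <- vs) d%:R)).
    rewrite [leLHS]big_seq [leRHS]big_seq.
    apply: ler_prod => v /vs1 v1; apply/andP; split.
      by apply: sumr_ge0 => i _; exact: normr_ge0.
    by rewrite (le_trans (l1norm_le v))// ler_piMr.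
  rewrite big_const_seq count_predT iter_mulr_1 ler_weXn2l// ler1n//.
split.
- move=> vs x vss cx.
  have [k sk] : exists k, sfloor s = (size vs + k.+1)%N.
    by exists (sfloor s - size vs).-1; lia.
  move: fT; rewrite {2}sk => /hoelder_tower_deriv[h [[g [gd _]] fh]].
  by have [] := diff_within_cube fh cx (gd x cx).
- move=> vs x y vss vs1 cx cy.
  move: fT; rewrite {2}(_ : sfloor s = size vs + 0)%N ?addn0//.
  rewrite -[X in hoelder_tower _ X](addn0 (size vs)).
  move=> /hoelder_tower_deriv[h [hT fh]].
  rewrite !fh ?inE// (le_trans (hT x y cx cy))// ler_wpM2r ?powR_ge0//.
  by apply: prodB; rewrite ?vss.
- move=> vs x vss vs1 cx; case: vs vss vs1 => [|v vs] vss vs1; first exact: fL.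
  move: fT; rewrite [X in hoelder_tower _ X](_ : sfloor s = (size vs + (sfloor s - size vs))%N); last first.
    by rewrite subnKC// ltnW.
  rewrite -(subnSK vss) => /hoelder_tower_deriv[h [[g [gd gT]] fh]].
  have -> : cube_deriv f (v :: vs) x = lincomb (g ^~ x) v.
    exact: (diff_within_cube fh cx (gd x cx)).2.
  rewrite (le_trans (lincomb_bound _ (fun i => (gT i).1 x cx)))// mulrA -(big_cons _ _ _ _ xpredT).
  exact: prodB.
Qed.
End tower.

(** * Sums of rescaled bumps over a grid *)

Section perturbation.
Context {R : realType} {d : nat}.
Variables (K kappa : nat).
Implicit Types (x y : 'rV[R]_d) (alpha : 'I_d -> nat).

Local Notation cell := {ffun 'I_d -> 'I_kappa}.

Lemma is_diff_prod (V : normedModType R) (I : eqType) (s : seq I)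
    (u du : I -> V -> R^o) (x : V) :
  uniq s -> (forall i, is_diff x (u i) (du i)) ->
  is_diff x ((fun w => \prod_(i <- s) (u i w : R)) : V -> R^o)
    (fun v => \sum_(i <- s) \prod_(k <- s) (if k == i then du k v else u k x : R)).
Proof.
move=> + hu; elim: s => [_|a s IH /= /andP[as_ us]].
  have := is_diff_cst (1 : R^o) x.
  by congr (is_diff _ _ _); apply/funext => y; rewrite big_nil.
have := is_diffM (hu a) (IH us).
congr (is_diff _ _ _); apply/funext => v; first by rewrite big_cons.
rewrite big_cons addrC big_cons eqxx; congr (_ + _).
  rewrite [LHS]mulrC; congr (_ * _); apply: eq_big_seq => k ks.
  by case: eqP => // ka; rewrite -ka ks in as_.
rewrite [LHS]mulr_sumr; apply: eq_big_seq => i is_.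
by rewrite big_cons; case: eqP => // ai; rewrite ai is_ in as_.
Qed.

Lemma has_gradient_prod (h h' : 'I_d -> R -> R) x :
  (forall i, is_derive (x 0 i) 1 (h i) (h' i (x 0 i))) ->
  has_gradient (fun y => \prod_i h i (y 0 i)) x
    (fun i => \prod_k (if k == i then h' k (x 0 k) else h k (x 0 k))).
Proof.
move=> hd.
have hu i : is_diff x ((fun y : 'rV[R]_d => h i (y 0 i)) : 'rV[R]_d -> R^o)
    ((fun v => v 0 i * h' i (x 0 i)) : 'rV[R]_d -> R^o).
  have cl : linear (fun v : 'rV[R]_d => v 0 i : R^o) by move=> a u v; rewrite !mxE.
  pose c : {linear 'rV[R]_d -> R^o} := HB.pack (fun v : 'rV[R]_d => v 0 i : R^o)
    (GRing.isLinear.Build _ _ _ _ _ cl).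
  have cc : continuous c by exact: coord_continuous.
  have h1 : is_diff x c c by split; [exact: linear_differentiable|exact: diff_lin].
  have [hx1 hx2] := hd i.
  have hx3 : differentiable (h i : R^o -> R^o) (c x) by apply/derivable1_diffP.
  have := is_diff_comp h1 (differentiableP hx3).
  congr (is_diff _ _ _); apply/funext => v /=.
  rewrite -hx2 deriveE// -[in LHS](mulr1 (v 0 i)).
  pose D : {linear R^o -> R^o} := 'd (h i : R^o -> R^o) (c x).
  by rewrite -[LHS]/(D (v 0 i *: (1 : R^o))) linearZ_LR.
have := @is_diff_prod 'rV[R]_d _ _ _ _ x (index_enum_uniq _) hu.
congr (is_diff _ _ _); apply/funext => v.
rewrite /lincomb; apply: eq_bigr => i _.
rewrite (bigD1 i)//= [in RHS](bigD1 i)//= eqxx mulrA; congr (_ * _).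
by apply: eq_bigr => k /negPf ->.
Qed.

(** Up to a power of [kappa], the partial derivative of order [alpha i] in each
coordinate [i] of the bump of the cell [j]. *)
Definition cell_bump alpha (j : cell) x : R :=
  \prod_i bump K (alpha i) (kappa%:R * x 0 i - (j i)%:R).

Definition perturbation alpha (eps : cell -> R) x : R :=
  \sum_j eps j * cell_bump alpha j x.

Definition incr alpha (i : 'I_d) : 'I_d -> nat :=
  fun k => if k == i then (alpha k).+1 else alpha k.

Lemma sum_incr alpha i : (\sum_k incr alpha i k = (\sum_k alpha k).+1)%N.
Proof.
rewrite (bigD1 i)//= [in RHS](bigD1 i)//= /incr eqxx addSn; congr (_.+1 + _)%N.
by apply: eq_bigr => k /negPf ->.
Qed.

Lemma has_gradient_perturbation alpha eps x : (forall i, (alpha i).+2 <= K)%N ->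
  has_gradient (perturbation alpha eps) x
    (fun i => kappa%:R * perturbation (incr alpha i) eps x).
Proof.
move=> aK.
have hc j : has_gradient (cell_bump alpha j) x
    (fun i => kappa%:R * cell_bump (incr alpha i) j x).
  have hd i : is_derive (x 0 i) 1
      (fun t : R => bump K (alpha i) (kappa%:R * t - (j i)%:R))
      (kappa%:R * bump K (alpha i).+1 (kappa%:R * x 0 i - (j i)%:R)).
    have ds : is_derive (x 0 i) 1 (fun t : R => kappa%:R * t - (j i)%:R) kappa%:R.
      by apply: is_derive_eq; rewrite /GRing.scale/=; ring.
    rewrite mulrC.
    exact: (@is_derive1_comp _ (bump K (alpha i)) _ _ _ _ (is_derive_bump _ (aK i)) ds).
  have := @has_gradient_prod _
     (fun i t => kappa%:R * bump K (alpha i).+1 (kappa%:R * t - (j i)%:R)) x hd.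
  congr (has_gradient _ _ _); apply/funext => i.
  rewrite /cell_bump (bigD1 i)//= [in RHS](bigD1 i)//= eqxx -mulrA /incr eqxx.
  congr (_ * (_ * _)).
  by apply: eq_bigr => k /negPf ->.
have := has_gradient_sum eps hc.
congr (has_gradient _ _ _); apply/funext => i.
by rewrite /perturbation mulr_sumr; apply: eq_bigr => j _; rewrite mulrCA.
Qed.

(** At most one term is nonzero, as the shifted supports are disjoint. *)
Lemma sum_shift_le (h : R -> R) (M t : R) : 0 <= M ->
  (forall z, ~~ (0 < z < 1) -> h z = 0) -> (forall z, `|h z| <= M) ->
  \sum_(k < kappa) `|h (t - k%:R)| <= M.
Proof.
move=> M0 hout hM.
have [[k hk]|h0] := pselect (exists k : 'I_kappa, h (t - k%:R) != 0); last first.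
  rewrite big1// => k _; apply/eqP; rewrite normr_eq0.
  by apply: contrapT => hk; apply: h0; exists k; apply/negP.
rewrite (bigD1 k)//= big1 ?addr0// => l lk.
rewrite hout ?normr0//; apply/negP => /andP[l0 l1].
have /andP[k0 k1] : 0 < t - k%:R < 1 by apply: contraNT hk => /hout ->.
have kl : (k%:R : R) < l.+1%:R by rewrite -natr1; lra.
have lk' : (l%:R : R) < k.+1%:R by rewrite -natr1; lra.
move: kl lk'; rewrite !ltr_nat !ltnS => kl lk'.
by move: lk; rewrite -val_eqE /= eqn_leq lk' kl.
Qed.

(** Summing the absolute values over all cells factorizes into one sum for each
coordinate, where [sum_shift_le] applies. *)
Lemma perturbation_bound alpha eps x M : 0 <= M ->
  (forall i z, `|bump K (alpha i) z| <= M) -> (forall i, alpha i < K)%N ->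
  (forall j, `|eps j| <= 1) -> `|perturbation alpha eps x| <= M ^+ d.
Proof.
move=> M0 hM aK e1.
rewrite (le_trans (ler_norm_sum _ _ _))//.
apply: (@le_trans _ _ (\sum_(j : cell) \prod_i `|bump K (alpha i) (kappa%:R * x 0 i - (j i)%:R)|)).
  by apply: ler_sum => j _; rewrite normrM -normr_prod ler_piMl.
rewrite -(bigA_distr_bigA (fun i (k : 'I_kappa) => `|bump K (alpha i) (kappa%:R * x 0 i - k%:R)|)) /=.
rewrite -[X in _ <= _ ^+ X]card_ord -prodr_const; apply: ler_prod => i _.
rewrite sumr_ge0//=; apply: sum_shift_le => // z; exact: bump_out.
Qed.

Lemma perturbation_lipschitz alpha eps M : 0 <= M ->
  (forall a z, (a < K)%N -> `|bump K a z| <= M) -> (forall i, (alpha i).+2 <= K)%N ->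
  (forall j, `|eps j| <= 1) ->
  forall x y, `|perturbation alpha eps x - perturbation alpha eps y|
    <= d%:R * M ^+ d * (kappa%:R * enorm (x - y)).
Proof.
move=> M0 hM aK e1 x y.
have gB i z : `|kappa%:R * perturbation (incr alpha i) eps z| <= kappa%:R * M ^+ d.
  rewrite normrM ger0_norm// ler_wpM2l// perturbation_bound// => [k u|k].
    by apply: hM; rewrite /incr; case: eqP => _ //; exact: ltnW.
  by rewrite /incr; case: eqP => _ //; exact: ltnW.
have := has_gradient_lipschitz (fun z => has_gradient_perturbation eps z aK) gB x y.
move=> /le_trans; apply.
have := l1norm_le (x - y).
have kM : 0 <= kappa%:R * M ^+ d by rewrite mulr_ge0// exprn_ge0.
move=> /(ler_wpM2r kM)/le_trans; apply.
by rewrite le_eqVlt; apply/predU1P; left; ring.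
Qed.

Lemma min1_powR (a t : R) : 0 < a <= 1 -> 0 <= t -> Num.min 1 t <= t `^ a.
Proof.
move=> /andP[a0 a1] t0; have [t1|t1] := leP 1 t.
  by rewrite (le_trans _ (ge0_ler_powR (ltW a0) _ _ t1)) ?powR1 ?nnegrE.
have [->|tn0] := eqVneq t 0; first by rewrite powR_ge0.
by rewrite -[leLHS]powRr1// ger_powR// lt0r tn0 t0 ltW.
Qed.

(** The derivative of order [l] is of size [rho * kappa ^+ l], at most
[rho * kappa `^ s] as long as [l <= sfloor s]. The Hoelder bound at the last
order interpolates between the sup bound and the Lipschitz bound, whose constant
is larger by a factor [kappa]: [min 1 (kappa * e) <= (kappa * e) `^ a]. *)
Lemma perturbation_tower (s rho M : R) k alpha eps : 0 < s -> 0 <= M -> 0 <= rho ->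
  (0 < kappa)%N -> (0 < d)%N ->
  (forall a z, (a < K)%N -> `|bump K a z| <= M) -> (sfloor s + 2 <= K)%N ->
  (forall j, `|eps j| <= 1) ->
  (\sum_i alpha i + k)%N = sfloor s ->
  hoelder_tower (s - (sfloor s)%:R) k (rho * kappa%:R `^ s * (2 * d%:R * M ^+ d))
    (fun x => rho * kappa%:R ^+ (\sum_i alpha i) * perturbation alpha eps x).
Proof.
move=> s0 M0 rho0 k0 d0 hM sK e1.
have /andP[sl su] := sfloorP s0.
have kR1 : 1 <= kappa%:R :> R by rewrite ler1n.
have Md : 0 <= M ^+ d by rewrite exprn_ge0.
have d1 : 1 <= d%:R :> R by rewrite ler1n.
have alphaK (al : 'I_d -> nat) i : (\sum_i al i <= sfloor s)%N -> (al i + 2 <= K)%N.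
  move=> h; apply: leq_trans sK; rewrite leq_add2r; apply: leq_trans h.
  by rewrite (bigD1 i)//= leq_addr.
elim: k alpha => [|k IH] alpha ak /=.
  move=> x y _ _; rewrite -mulrBr normrM ger0_norm; last by rewrite mulr_ge0// exprn_ge0.
  rewrite addn0 in ak; rewrite ak.
  set a := s - _; set e := enorm _.
  have e0 : 0 <= e by exact: sqrtr_ge0.
  have a01 : 0 < a <= 1 by rewrite /a; rewrite -natr1 in su; lra.
  have -> : kappa%:R `^ s = kappa%:R ^+ sfloor s * kappa%:R `^ a.
    rewrite -powR_mulrn// -powRD; first by rewrite /a addrC subrK.
    by rewrite pnatr_eq0 -lt0n k0 implybT.
  have -> : rho * (kappa%:R ^+ sfloor s * kappa%:R `^ a) * (2 * d%:R * M ^+ d) * e `^ a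
    = rho * kappa%:R ^+ sfloor s * (2 * d%:R * M ^+ d * (kappa%:R `^ a * e `^ a)) by ring.
  rewrite ler_wpM2l//; first by rewrite mulr_ge0// exprn_ge0.
  rewrite -powRM//.
  have := min1_powR a01 (mulr_ge0 (ler0n _ kappa) e0).
  have bx z : `|perturbation alpha eps z| <= M ^+ d.
    apply: perturbation_bound => // [i u|i]; first apply: hM.
      by have := alphaK alpha i; rewrite ak => /(_ (leqnn _)); lia.
    by have := alphaK alpha i; rewrite ak => /(_ (leqnn _)); lia.
  have D1 : `|perturbation alpha eps x - perturbation alpha eps y| <= 2 * M ^+ d.
    by rewrite (le_trans (ler_normB _ _))// mulr_natl mulr2n lerD.
  have D2 : `|perturbation alpha eps x - perturbation alpha eps y| <= d%:R * M ^+ d * (kappa%:R * e).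
    apply: perturbation_lipschitz => // i.
    by have := alphaK alpha i; rewrite ak => /(_ (leqnn _)); lia.
  set t := kappa%:R * e in D2 *; set D := `|_| in D1 D2 *.
  have dM : 0 <= d%:R * M ^+ d by rewrite mulr_ge0.
  have d2M : 0 <= 2 * d%:R * M ^+ d by rewrite !mulr_ge0.
  move=> /(ler_wpM2l d2M) minP; apply: le_trans minP.
  have [_|_] := leP 1 t.
    rewrite mulr1 (le_trans D1)// -mulrA ler_pM2l// ler_peMl//.
  rewrite (le_trans D2)// (_ : 2 * _ * _ * t = 2 * (d%:R * M ^+ d * t)); last by ring.
  by rewrite ler_peMl// ?mulr_ge0// ler1n.
have ikS i : (\sum_l incr alpha i l + k)%N = sfloor s by rewrite sum_incr addSnnS.
exists (fun i x => rho * kappa%:R ^+ (\sum_l incr alpha i l) * perturbation (incr alpha i) eps x).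
split=> [x _|i].
  have aK i : ((alpha i).+2 <= K)%N by rewrite -addn2 alphaK// -ak leq_addr.
  have := has_gradient_sum (I := 'I_1) (fun=> rho * kappa%:R ^+ (\sum_i alpha i))
    (fun=> has_gradient_perturbation eps x aK).
  congr (has_gradient _ _ _); apply/funext => i; rewrite big_ord1//.
  by rewrite sum_incr exprSr !mulrA.
split; last exact: IH.
move=> x _; rewrite normrM ger0_norm; last by rewrite mulr_ge0// exprn_ge0.
have iK l : (incr alpha i l < K)%N.
  by have := alphaK _ l (leq_trans (leq_addr k _) (eq_leq (ikS i))); lia.
rewrite -!mulrA ler_wpM2l// ler_pM ?exprn_ge0//.
  rewrite -powR_mulrn// ler_powR// (le_trans _ (ltW sl))// ler_nat -(ikS i).
  exact: leq_addr.
apply: (@le_trans _ _ (M ^+ d)).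
  by apply: perturbation_bound => // l z; apply: hM.
by rewrite mulrA ler_peMl//; lra.
Qed.
End perturbation.

(** * Integrals over product spaces and change of density *)

Section bounded_measurable.
Context {disp : measure_display} {T : measurableType disp} {R : realType}.
Implicit Types (f g : T -> R) (P : probability T R).

Definition bmeas f :=
  measurable_fun setT f /\ exists M, forall x, `|f x| <= M.

Lemma bmeas_cst c : bmeas (fun=> c).
Proof. by split; [exact: measurable_cst|exists `|c|]. Qed.

Lemma bmeasD f g : bmeas f -> bmeas g -> bmeas (fun x => f x + g x).
Proof.
move=> [mf [M fM]] [mg [N gN]]; split; first exact: measurable_funD.
by exists (M + N) => x; rewrite (le_trans (ler_normD _ _))// lerD.
Qed.

Lemma bmeasM f g : bmeas f -> bmeas g -> bmeas (fun x => f x * g x).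
Proof.
move=> [mf [M fM]] [mg [N gN]]; split; first exact: measurable_funM.
by exists (M * N) => x; rewrite normrM ler_pM.
Qed.

Lemma bmeasZ c f : bmeas f -> bmeas (fun x => c * f x).
Proof. exact: bmeasM (bmeas_cst c). Qed.

Lemma bmeasB f g : bmeas f -> bmeas g -> bmeas (fun x => f x - g x).
Proof.
move=> bf bg; have := bmeasD bf (bmeasZ (- 1) bg).
by under eq_fun do rewrite mulN1r.
Qed.

Lemma bmeas_sum (I : Type) (s : seq I) (F : I -> T -> R) :
  (forall i, bmeas (F i)) -> bmeas (fun x => \sum_(i <- s) F i x).
Proof.
move=> bF; elim: s => [|i s IH].
  by under eq_fun do rewrite big_nil; exact: bmeas_cst.
by under eq_fun do rewrite big_cons; exact: bmeasD.
Qed.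

Lemma bmeas_prod (I : Type) (s : seq I) (F : I -> T -> R) :
  (forall i, bmeas (F i)) -> bmeas (fun x => \prod_(i <- s) F i x).
Proof.
move=> bF; elim: s => [|i s IH].
  by under eq_fun do rewrite big_nil; exact: bmeas_cst.
by under eq_fun do rewrite big_cons; exact: bmeasM.
Qed.

Lemma bmeas_integrable P f : bmeas f -> P.-integrable setT (EFin \o f).
Proof.
move=> [mf [M fM]].
apply: (@le_integrable _ _ _ _ _ _ _ (EFin \o cst M)) => //.
- exact/measurable_EFinP.
- move=> x _ /=; rewrite lee_fin (le_trans (fM x))// ler_norm//.
- exact: finite_measure_integrable_cst.
Qed.

Lemma EFin_Rintegral P f : bmeas f ->
  (\int[P]_x f x)%:E = (\int[P]_x (f x)%:E)%E.
Proof. by move=> bf; rewrite fineK//; exact/integrable_fin_num/bmeas_integrable. Qed.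

Lemma Rintegral_cst1 P c : \int[P]_x c = c.
Proof. 
rewrite Rintegral_cst// -[RHS]mulr1; congr (_ * _); rewrite -[RHS]/(fine 1%E); congr fine.
exact: probability_setT.
Qed.

Lemma bmeas_RintegralD P f g : bmeas f -> bmeas g ->
  \int[P]_x (f x + g x) = \int[P]_x f x + \int[P]_x g x.
Proof. by move=> bf bg; rewrite RintegralD//; exact: bmeas_integrable. Qed.

Lemma bmeas_RintegralZ P c f : bmeas f ->
  \int[P]_x (c * f x) = c * \int[P]_x f x.
Proof. by move=> bf; rewrite RintegralZl//; exact: bmeas_integrable. Qed.

Lemma bmeas_Rintegral_sum P (I : Type) (s : seq I) (F : I -> T -> R) :
  (forall i, bmeas (F i)) ->
  \int[P]_x (\sum_(i <- s) F i x) = \sum_(i <- s) \int[P]_x F i x.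
Proof.
move=> bF; elim: s => [|i s IH].
  by under eq_Rintegral do rewrite big_nil; rewrite Rintegral_cst1 big_nil.
under eq_Rintegral do rewrite big_cons.
by rewrite bmeas_RintegralD ?big_cons ?IH//; exact: bmeas_sum.
Qed.

Lemma bmeas_le_Rintegral P f g : bmeas f -> bmeas g -> (forall x, f x <= g x) ->
  \int[P]_x f x <= \int[P]_x g x.
Proof. by move=> bf bg fg; apply: le_Rintegral => //; exact: bmeas_integrable. Qed.

End bounded_measurable.

Section product_measures.
Context {R : realType}.

Lemma bmeas_comp d1 d2 (T1 : measurableType d1) (T2 : measurableType d2)
    (f : T2 -> R) (h : T1 -> T2) :
  bmeas f -> measurable_fun setT h -> bmeas (fun x => f (h x)).
Proof.
move=> [mf [M fM]] mh; split; last by exists M => x; exact: fM.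
exact: (measurableT_comp mf mh).
Qed.

Lemma Rintegral_product d1 d2 (T1 : measurableType d1) (T2 : measurableType d2)
    (P1 : probability T1 R) (P2 : probability T2 R) (u : T1 -> R) (v : T2 -> R) :
  bmeas u -> bmeas v ->
  \int[(P1 \x P2)%E]_z (u z.1 * v z.2) = \int[P1]_x u x * \int[P2]_y v y.
Proof.
move=> bu bv.
have bw : bmeas (fun z : T1 * T2 => u z.1 * v z.2).
  apply: bmeasM; first exact: (bmeas_comp bu measurable_fst).
  exact: (bmeas_comp bv measurable_snd).
apply: EFin_inj; rewrite EFin_Rintegral//.
rewrite -integral12_prod_meas1; last exact: (bmeas_integrable (P1 \x P2)%E bw).
rewrite /fubini_F/=.
under eq_integral => x _ do rewrite -(EFin_Rintegral P2 (bmeasZ (u x) bv)).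
under eq_integral => x _ do rewrite bmeas_RintegralZ// mulrC.
by rewrite -EFin_Rintegral ?bmeas_RintegralZ// 1?mulrC//; exact: bmeasZ.
Qed.

Lemma Rintegral_prob_pow d (T : measurableType d) (P : probability T R) n
    (h : 'I_n -> T -> R) : (forall i, bmeas (h i)) ->
  \int[prob_pow P n]_t (\prod_i h i (tnth t i)) = \prod_i \int[P]_x h i x.
Proof.
elim: n h => [|n IH] h bh /=.
  rewrite big_ord0; under eq_Rintegral do rewrite big_ord0.
  by rewrite Rintegral_cst1.
have bp (m : nat) (k : 'I_m -> T -> R) : (forall i, bmeas (k i)) ->
    bmeas (fun t : m.-tuple T => \prod_i k i (tnth t i)).
  move=> bk; apply: bmeas_prod => i.
  by apply: (bmeas_comp (bk i)); exact: measurable_tnth.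
have bq : bmeas (fun z : T * n.-tuple T => \prod_i h i (tnth (tcons z) i)).
  exact: (bmeas_comp (bp _ _ bh) (@measurable_tcons _ _ _)).
transitivity (\int[(P \x prob_pow P n)%E]_z (\prod_i h i (tnth (tcons z) i))).
  apply: EFin_inj; rewrite !EFin_Rintegral//; last exact: bp.
  rewrite integral_distribution//.
    by apply/measurable_EFinP; have [] := bp _ _ bh.
  exact: (bmeas_integrable (P \x prob_pow P n)%E bq).
under eq_Rintegral => z _.
  rewrite big_ord_recl (_ : tnth _ ord0 = z.1)//.
  under eq_bigr do rewrite tnthS.
  over.
rewrite big_ord_recl -IH//.
exact: Rintegral_product (bh ord0) (bp _ _ (fun i => bh (lift ord0 i))).
Qed.

Import HBNNSimple.

(** Both sides commute with monotone limits, and they agree on simple functions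
by the assumption on [nu]. *)
Lemma ge0_integral_density d (T : measurableType d)
    (P nu : {measure set T -> \bar R}) (w : T -> R) (h : T -> \bar R) :
  measurable_fun setT w -> (forall x, 0 <= w x) ->
  (forall A, measurable A -> nu A = \int[P]_(x in A) (w x)%:E)%E ->
  measurable_fun setT h -> (forall x, 0 <= h x)%E ->
  (\int[nu]_x h x = \int[P]_x (h x * (w x)%:E))%E.
Proof.
move=> mw w0 nuE mh h0.
have mwE : measurable_fun setT (EFin \o w) by exact/measurable_EFinP.
pose f := nnsfun_approx measurableT mh.
have fh x : (f n x)%:E @[n --> \oo] --> h x by apply: cvg_nnsfun_approx.
have fnd x : {homo (fun n => (f n x)%:E) : m n / (m <= n)%N >-> (m <= n)%E}.
  by move=> m n mn; rewrite lee_fin; exact/lefP/nd_nnsfun_approx.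
have mfn n : measurable_fun setT (EFin \o f n).
  exact/measurable_EFinP/measurable_funP.
have simple n : (\int[nu]_x (f n x)%:E = \int[P]_x ((f n x)%:E * (w x)%:E))%E.
  rewrite integralT_nnsfun sintegralE.
  transitivity (\int[P]_x (\sum_(r \in range (f n))
      (r * \1_(f n @^-1` [set r]) x * w x)%:E))%E; last first.
    apply: eq_integral => x _; rewrite -EFinM fimfunE fsumEFin//; congr EFin.
    by rewrite mulr_fsuml.
  rewrite ge0_integral_fsum//; last 2 first.
  - by move=> r; apply/measurable_EFinP; apply: measurable_funM => //; exact: measurable_funM.
  - move=> r x _; rewrite EFinM mule_ge0//; [exact: nnfun_muleindic_ge0|].
    by rewrite lee_fin.
  apply: eq_fsbigr => r; rewrite inE => -[x _ <-].
  have mA : measurable (f n @^-1` [set f n x]) by [].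
  rewrite nuE// integral_mkcond -ge0_integralZl//; first last.
  - by rewrite lee_fin.
  - by move=> y _; rewrite patchE; case: ifPn => // _; rewrite lee_fin.
  - by apply/(measurable_restrictT _ mA).1; exact: measurable_funTS.
  apply: eq_integral => y _; rewrite patchE indicE -mulrA EFinM.
  by case: (y \in _); rewrite ?mul1r ?mul0r.
transitivity (limn (fun n => \int[nu]_x (f n x)%:E))%E.
  rewrite -monotone_convergence//.
    by apply: eq_integral => x _; apply/esym/cvg_lim => //; exact: fh.
  by move=> n x _; rewrite lee_fin.
under eq_fun do rewrite simple.
rewrite -monotone_convergence//.
- by apply: eq_integral => x _; apply/cvg_lim => //; apply: cvgeZr.
- by move=> n; exact: (emeasurable_funM (mfn n) mwE).
- by move=> n x _; rewrite mule_ge0// lee_fin.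
- by move=> x _ m n mn; rewrite lee_wpmul2r ?lee_fin//; exact: fnd.
Qed.

(** Formulated on integrals rather than on sets, absolute continuity passes to
products by Tonelli's theorem. *)
Definition has_density d (T : measurableType d) (nu P : probability T R)
    (w : T -> R) :=
  [/\ measurable_fun setT w, (forall x, 0 <= w x) &
    forall h : T -> \bar R, measurable_fun setT h -> (forall x, 0 <= h x)%E ->
      (\int[nu]_x h x = \int[P]_x (h x * (w x)%:E))%E].

Lemma has_density_product d1 d2 (T1 : measurableType d1) (T2 : measurableType d2)
    (nu1 P1 : probability T1 R) (nu2 P2 : probability T2 R) w1 w2 :
  has_density nu1 P1 w1 -> has_density nu2 P2 w2 ->
  has_density (nu1 \x nu2)%E (P1 \x P2)%E (fun z => w1 z.1 * w2 z.2).
Proof.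
move=> [mw1 w10 D1] [mw2 w20 D2].
have mw : measurable_fun setT (fun z : T1 * T2 => w1 z.1 * w2 z.2).
  apply: measurable_funM; first exact: (measurableT_comp mw1 measurable_fst).
  exact: (measurableT_comp mw2 measurable_snd).
split=> //; first by move=> z; rewrite mulr_ge0.
move=> h mh h0.
have mhw2 : measurable_fun setT (fun z : T1 * T2 => h z * (w2 z.2)%:E)%E.
  apply: emeasurable_funM => //; apply/measurable_EFinP.
  exact: (measurableT_comp mw2 measurable_snd).
have hw20 z : (0 <= h z * (w2 z.2)%:E)%E by rewrite mule_ge0// lee_fin.
rewrite [LHS](fubini_tonelli1 h)// [RHS](fubini_tonelli1 (fun z => h z * (w1 z.1 * w2 z.2)%:E)%E); first last.
- by move=> z; rewrite mule_ge0// lee_fin mulr_ge0.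
- by apply: emeasurable_funM => //; exact/measurable_EFinP.
rewrite /fubini_F/=.
have innerE x : (\int[nu2]_y h (x, y) = \int[P2]_y (h (x, y) * (w2 y)%:E))%E.
  by rewrite D2//; exact: (measurableT_comp mh (pair1_measurable x)).
under eq_integral => x _ do rewrite innerE.
rewrite D1; first last.
- by move=> x; apply: integral_ge0 => y _; exact: (hw20 (x, y)).
- exact: (measurable_fun_fubini_tonelli_F (fun z => h z * (w2 z.2)%:E)%E).
apply: eq_integral => x _.
rewrite muleC -ge0_integralZl//; first last.
- by rewrite lee_fin.
- exact: (measurableT_comp mhw2 (pair1_measurable x)).
by apply: eq_integral => y _; rewrite muleCA -EFinM.
Qed.

(** A power is the image of an iterated product under [tcons]. *)
Lemma has_density_prob_pow d (T : measurableType d) (nu P : probability T R) w n :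
  has_density nu P w ->
  has_density (prob_pow nu n) (prob_pow P n) (fun t => \prod_i w (tnth t i)).
Proof.
move=> D; have [mw w0 _] := D; elim: n => [|n IH].
  have E t : \prod_(i < 0) w (tnth t i) = 1 by rewrite big_ord0.
  split=> [|t|h mh h0].
  - by rewrite (_ : (fun t => _) = cst 1)//; apply/funext => t; exact: E.
  - by rewrite E.
  by apply: eq_integral => x _; rewrite big_ord0 mule1.
have [_ _ IH'] := has_density_product D IH.
have mW : measurable_fun setT (fun t : n.+1.-tuple T => \prod_i w (tnth t i)).
  apply: measurable_prod => i _; apply: (measurableT_comp mw).
  exact: measurable_tnth.
have W0 (t : n.+1.-tuple T) : 0 <= \prod_i w (tnth t i) by exact: prodr_ge0.
split=> // h mh h0.
have mhc : measurable_fun setT (h \o @tcons _ T n).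
  by apply: measurableT_comp => //; exact: measurable_tcons.
rewrite [LHS]ge0_integral_distribution// [RHS]ge0_integral_distribution; first last.
- by move=> t; rewrite mule_ge0// lee_fin.
- by apply: emeasurable_funM => //; exact/measurable_EFinP.
rewrite [LHS]IH'//; last by move=> z; exact: h0.
apply: eq_integral => z _ /=; rewrite big_ord_recl.
by under [in RHS]eq_bigr do rewrite tnthS.
Qed.

End product_measures.

(** * Exponential moments of a Rademacher chaos *)

Section rademacher.
Context {R : realType}.

Definition rsign (b : bool) : R := (-1) ^+ b.

(** From [expR x <= (1 - x)^-1], which is [1 + y <= expR y] at [y = - x]. *)
Lemma expR_sym_le (x : R) : x ^+ 2 < 1 -> expR x + expR (- x) <= 2 / (1 - x ^+ 2).
Proof.
move=> x1; have x11 : `|x| < 1 by rewrite -(@expr_lt1 _ 2%N)// real_normK// num_real.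
move: x11; rewrite ltr_norml => /andP[xl xr].
have inv (y : R) : y < 1 -> expR y <= (1 - y)^-1.
  move=> y1; rewrite -[expR y]invrK -expRN lef_pV2 ?posrE ?subr_gt0 ?expR_gt0//.
  exact: expR_ge1Dx.
have := inv (- x); rewrite opprK => /(_ _)/= hn; have hp := inv x xr.
apply: (le_trans (lerD hp (hn _))); first by lra.
rewrite le_eqVlt; apply/predU1P; left; field.
by rewrite !lt0r_neq0//; lra.
Qed.

(** Weierstrass' product inequality. *)
Lemma prod_1B_ge (I : Type) (s : seq I) (y : I -> R) : (forall i, 0 <= y i <= 1) ->
  1 - \sum_(i <- s) y i <= \prod_(i <- s) (1 - y i).
Proof.
move=> y01; have p01 (r : seq I) : 0 <= \prod_(i <- r) (1 - y i) <= 1.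
  by elim/big_ind : _ => [|u v|i _]; [lra|nra|have := y01 i; lra].
elim: s => [|i s IH]; first by rewrite !big_nil subr0.
rewrite !big_cons; have := y01 i; have := p01 s; nra.
Qed.

(** For a fixed [eta] the sum over [eta'] factorizes over [J], and each factor is
[expR (x j) + expR (- x j)] whatever the sign of [eta j]. *)
Lemma sum_rademacher (J : finType) (x : J -> R) : \sum_j x j ^+ 2 < 1 ->
  \sum_(eta : {ffun J -> bool}) \sum_(eta' : {ffun J -> bool})
    expR (\sum_j x j * (rsign (eta j) * rsign (eta' j)))
  <= (#|{ffun J -> bool}|%:R) ^+ 2 / (1 - \sum_j x j ^+ 2).
Proof.
move=> x1.
have xj1 j : x j ^+ 2 < 1.
  apply: le_lt_trans x1; rewrite (bigD1 j)//= lerDl.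
  by apply: sumr_ge0 => i _; exact: sqr_ge0.
set D := 1 - _; have D0 : 0 < D by rewrite subr_gt0.
have inner (eta : {ffun J -> bool}) : \sum_(eta' : {ffun J -> bool})
    expR (\sum_j x j * (rsign (eta j) * rsign (eta' j))) <=
    #|{ffun J -> bool}|%:R / D.
  under eq_bigr do rewrite expR_sum.
  rewrite -(bigA_distr_bigA (fun j b => expR (x j * (rsign (eta j) * rsign b))))/=.
  apply: (@le_trans _ _ (\prod_(j : J) (2 / (1 - x j ^+ 2)))).
    apply: ler_prod => j _; rewrite big_bool/= addr_ge0 ?expR_ge0//=.
    rewrite /rsign; case: (eta j); rewrite !(expr0, expr1, mulr1, mul1r, mulrN1, opprK, mulrN).
      exact: expR_sym_le.
    by rewrite addrC; exact: expR_sym_le.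
  rewrite big_split/= prodr_const card_ffun card_bool natrX ler_wpM2l//.
  rewrite prodfV lef_pV2 ?posrE//; last first.
    by apply: prodr_gt0 => j _; rewrite subr_gt0.
  by apply: prod_1B_ge => j; rewrite sqr_ge0 ltW.
apply: (le_trans (ler_sum _ (fun eta _ => inner eta))).
by rewrite sumr_const -[leLHS]mulr_natl expr2 mulrA.
Qed.

End rademacher.

(** * Two-point method for a mixture of alternatives *)

Section le_cam.
Context {disp : measure_display} {T : measurableType disp} {R : realType}.
Variable (Q : probability T R).

(** [Z i] is the likelihood of the alternative [i], and [Zbar] below that of the
uniform mixture. With [u = 1 - phi x], the pointwise bound
[phi + u * Zbar >= 3 / 4 - (Zbar - 1) ^ 2] is
[(Zbar - 1 + u / 2) ^ 2 + (1 - u ^ 2) / 4 >= 0]. Since the average of the errors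
is at least [1 / 2], so is one of them. *)
Lemma exists_large_error (I : finType) (Z : I -> T -> R) (phi : T -> R) :
  (0 < #|I|)%N -> (forall i, bmeas (Z i)) -> (forall i, \int[Q]_x Z i x = 1) ->
  \sum_i \sum_j \int[Q]_x (Z i x * Z j x) <= 5 / 4 * (#|I|%:R) ^+ 2 ->
  bmeas phi -> (forall x, 0 <= phi x <= 1) ->
  exists i, 1 / 2 <= \int[Q]_x phi x + \int[Q]_x ((1 - phi x) * Z i x).
Proof.
move=> I0 bZ Z1 Z2 bphi phi01; apply: contrapT => noti.
have N0 : 0 < #|I|%:R :> R by rewrite ltr0n.
set N := #|I|%:R in Z2 N0.
have bphi1 : bmeas (fun x => 1 - phi x) by exact: bmeasB (bmeas_cst 1) bphi.
have bphiZ i : bmeas (fun x => (1 - phi x) * Z i x) by exact: bmeasM.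
have lt i : \int[Q]_x phi x + \int[Q]_x ((1 - phi x) * Z i x) < 1 / 2.
  by rewrite ltNge; apply/negP => h; apply: noti; exists i.
pose Zbar x := N^-1 * \sum_i Z i x.
have bZbar : bmeas Zbar by apply: bmeasZ; exact: bmeas_sum.
have Zbar1 : \int[Q]_x Zbar x = 1.
  rewrite bmeas_RintegralZ; last exact: bmeas_sum.
  rewrite bmeas_Rintegral_sum//; under eq_bigr do rewrite Z1.
  by rewrite sumr_const mulVf// gt_eqF.
have Zbar2 : \int[Q]_x (Zbar x * Zbar x) <= 5 / 4.
  under eq_Rintegral => x _.
    rewrite (_ : Zbar x * Zbar x = N^-1 ^+ 2 * \sum_i \sum_j (Z i x * Z j x)); last first.
      rewrite /Zbar mulrACA expr2; congr (_ * _); rewrite mulr_suml.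
      by apply: eq_bigr => i _; rewrite mulr_sumr.
    over.
  have bZZ i j : bmeas (fun x => Z i x * Z j x) by exact: bmeasM.
  rewrite bmeas_RintegralZ; last by apply: bmeas_sum => i; exact: bmeas_sum.
  rewrite bmeas_Rintegral_sum; last by move=> i; exact: bmeas_sum.
  under eq_bigr do rewrite bmeas_Rintegral_sum//.
  by rewrite mulrC exprVn ler_pdivrMr// exprn_gt0.
have avg : N^-1 * \sum_i (\int[Q]_x phi x + \int[Q]_x ((1 - phi x) * Z i x)) =
    \int[Q]_x (phi x + (1 - phi x) * Zbar x).
  rewrite big_split/= sumr_const mulrDr -[X in _ * X]mulr_natl mulKf ?gt_eqF//.
  rewrite -bmeas_Rintegral_sum// -bmeas_RintegralZ; last exact: bmeas_sum.
  rewrite -bmeas_RintegralD//; last by apply: bmeasZ; exact: bmeas_sum.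
  apply: eq_Rintegral => x _; congr (_ + _).
  by rewrite -mulr_sumr /Zbar mulrCA.
have : \int[Q]_x (phi x + (1 - phi x) * Zbar x) < 1 / 2.
  rewrite -avg mulrC ltr_pdivrMr// mulr_natr -sumr_const.
  have [i0 _] := card_gt0P I0.
  by apply: ltr_sum => //; apply/hasP; exists i0; rewrite ?mem_index_enum.
apply/negP; rewrite -leNgt.
have bZ2 : bmeas (fun x => Zbar x * Zbar x) by exact: bmeasM.
have bZZ := bmeasD (bmeasZ (- 1) bZ2) (bmeas_cst (- (1 / 4) : R)).
apply: (@le_trans _ _ (\int[Q]_x (2 * Zbar x + (- 1 * (Zbar x * Zbar x) + - (1 / 4))))).
  rewrite (bmeas_RintegralD _ (bmeasZ 2 bZbar) bZZ).
  rewrite (bmeas_RintegralD _ (bmeasZ (- 1) bZ2) (bmeas_cst _)).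
  rewrite (bmeas_RintegralZ Q 2 bZbar) (bmeas_RintegralZ Q (- 1) bZ2).
  by rewrite (Rintegral_cst1 Q (- (1 / 4))) Zbar1; lra.
apply: bmeas_le_Rintegral.
- by apply: bmeasD => //; exact: bmeasZ.
- by apply: bmeasD => //; exact: bmeasM.
- move=> x; have := phi01 x; set u := phi x; set z := Zbar x.
  have := sqr_ge0 (z - 1 + (1 - u) / 2); nra.
Qed.

End le_cam.

(** * Integrals of the bumps *)

Section interval_integrals.
Context {R : realType}.
Local Notation U := (@unit_lebesgue R).

Lemma ge0_integral_unit_lebesgue (h : R -> \bar R) :
  measurable_fun [set: measurableTypeR R] h -> (forall x, 0 <= h x)%E ->
  (\int[U]_x h x = \int[lebesgue_measure]_(x in `[0%R, 1%R]%classic) h x)%E.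
Proof.
move=> mh h0.
have m01 : measurable (`[0, 1]%classic : set (measurableTypeR R)) by [].
rewrite (@ge0_integral_density _ _ _ lebesgue_measure U (\1_(`[0, 1]%classic : set (measurableTypeR R))))//.
- rewrite [RHS]integral_mkcond; apply: eq_integral => x _; rewrite patchE indicE.
  by case: (x \in _); rewrite ?mule1 ?mule0.
- by move=> A mA; rewrite integral_indic// setIC.
Qed.

Lemma unit_lebesgue_itv (a b : R) : 0 <= a -> a <= b -> b <= 1 ->
  \int[U]_x (\1_(`[a, b]%classic : set (measurableTypeR R)) x) = b - a.
Proof.
move=> a0 ab b1.
rewrite /Rintegral ge0_integral_unit_lebesgue//; last first.
  by apply/measurable_EFinP; exact: measurable_indic.
rewrite integral_indic// setIidl; last first.
  by move=> x /=; rewrite !in_itv/= => /andP[xa xb]; rewrite (le_trans a0)// (le_trans xb).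
rewrite -[X in fine X]/(lebesgue_measure [set` `[a, b]]) lebesgue_measure_itv/= lte_fin; case: ltgtP ab => //= -> _.
by rewrite subrr.
Qed.

(** The comparison of integrals over [U] and over the unit interval is for
nonnegative functions, hence the proof shifts [f] by the constant [1]. *)
Lemma Rintegral_unit_FTC (f F : R -> R) : bmeas (f : measurableTypeR R -> R) ->
  continuous f -> (forall x, - 1 <= f x) ->
  (forall x : R, is_derive x 1 F (f x)) -> \int[U]_x f x = F 1 - F 0.
Proof.
move=> bf cf f1 dF.
have b1 := bmeas_cst (1 : R) : bmeas (fun _ : measurableTypeR R => 1).
have dG (x : R) : is_derive x 1 (F + id) (f x + 1).
  by have dFx := dF x; exact: is_deriveD.
have cG : continuous (F + id : R -> R).
  move=> x; apply/differentiable_continuous/derivable1_diffP.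
  by have [] := dG x.
suff : \int[U]_x (f x + 1) = F 1 + 1 - (F 0 + 0).
  by rewrite bmeas_RintegralD// (Rintegral_cst1 U 1); lra.
rewrite /Rintegral ge0_integral_unit_lebesgue; last first.
- by move=> x; rewrite lee_fin; have := f1 x; lra.
- by apply/measurable_EFinP; case: (bmeasD bf b1).
rewrite (@continuous_FTC2 _ (fun x => f x + 1) (F + id))//.
- apply: continuous_subspaceT => x.
  by apply: cvgD; [exact: cf|exact: cvg_cst].
- split; first by move=> x _; have [] := dG x.
  + exact/cvg_at_right_filter/cG.
  + exact/cvg_at_left_filter/cG.
- by move=> x _; rewrite derive1E; have [] := dG x.
Qed.

Variables (K kappa : nat).
Hypotheses (K2 : (1 < K)%N) (kappa0 : (0 < kappa)%N).

Definition cell_bump1 (k : 'I_kappa) (x : R) : R := bump K 0 (kappa%:R * x - k%:R).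

Lemma continuous_cell_bump1 k : continuous (cell_bump1 k).
Proof.
move=> x; rewrite (_ : cell_bump1 k = bump K 0 \o (fun x => kappa%:R * x - k%:R))//.
apply: continuous_comp; last exact: continuous_bump0.
by apply: cvgB; [exact: mulrl_continuous|exact: cvg_cst].
Qed.

Lemma bmeas_cell_bump1 k : bmeas (cell_bump1 k : measurableTypeR R -> R).
Proof.
split; last by exists 1 => x; apply: bump0_le1; exact: ltnW.
exact: (continuous_measurable_fun (@continuous_cell_bump1 k)).
Qed.

Lemma Rintegral_cell_bump1 k : \int[U]_x cell_bump1 k x = 0.
Proof.
have [n Kn] : exists n, K = n.+2 by exists K.-2; lia.
have kR : kappa%:R != 0 :> R by rewrite pnatr_eq0 -lt0n.
pose P (z : R) := n.+3%:R^-1 * well z ^+ n.+3.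
pose F (x : R) := kappa%:R^-1 * P (kappa%:R * x - k%:R).
have dF (x : R) : is_derive x 1 F (cell_bump1 k x).
  have ds : is_derive x 1 (fun t : R => kappa%:R * t - k%:R) kappa%:R.
    by apply: is_derive_eq; rewrite /GRing.scale/=; ring.
  have dP := is_derive_bump_primitive n.+1 (kappa%:R * x - k%:R).
  have := is_deriveZ kappa%:R^-1 (@is_derive1_comp _ P (fun t => kappa%:R * t - k%:R) x _ _ dP ds).
  by rewrite /GRing.scale/= mulrCA mulVf// mulr1 /cell_bump1 Kn.
rewrite (Rintegral_unit_FTC (bmeas_cell_bump1 k) _ _ dF); last 2 first.
- exact: continuous_cell_bump1.
- move=> x; have := bump0_le1 (kappa%:R * x - k%:R) (ltnW K2).
  by rewrite ler_norml => /andP[].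
have k1 : k%:R + 1 <= kappa%:R :> R by rewrite natr1 ler_nat.
have k0 : 0 <= k%:R :> R by [].
by rewrite /F /P !well_out ?expr0n ?mulr0 ?subrr//; apply/negP => /andP[]; lra.
Qed.

Lemma cell_bump1_disjoint k l x : k != l -> cell_bump1 k x * cell_bump1 l x = 0.
Proof.
move=> kl; have [x0|x0] := boolP (0 < kappa%:R * x - k%:R < 1); last first.
  by rewrite /cell_bump1 (bump_out _ x0) ?mul0r// ltnW.
have [y0|y0] := boolP (0 < kappa%:R * x - l%:R < 1); last first.
  by rewrite /cell_bump1 (bump_out _ y0) ?mulr0// ltnW.
have lk : (k%:R : R) < l.+1%:R by rewrite -natr1; lra.
have lk' : (l%:R : R) < k.+1%:R by rewrite -natr1; lra.
move: lk lk'; rewrite !ltr_nat !ltnS => h1 h2.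
by move: kl; rewrite -val_eqE /= eqn_leq h1 h2.
Qed.

(** The lower bound of [bump0_ge] times the length [1 / 8] of the interval
from [1 / 8] to [1 / 4] on which it holds. *)
Definition bump_min : R := (2^-1 * (7 / 64) ^+ K) ^+ 2 / 8.

Lemma Rintegral_cell_bump1_sqr k :
  bump_min / kappa%:R <= \int[U]_x (cell_bump1 k x * cell_bump1 k x) <= kappa%:R^-1.
Proof.
have kR : 0 < kappa%:R :> R by rewrite ltr0n.
have k1 : k%:R + 1 <= kappa%:R :> R by rewrite natr1 ler_nat.
have k0 : 0 <= k%:R :> R by [].
have bp := bmeasM (bmeas_cell_bump1 k) (bmeas_cell_bump1 k).
have bi (a b : R) : bmeas (\1_(`[a, b]%classic : set (measurableTypeR R)) : _ -> R).
  split; first exact: measurable_indic.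
  by exists 1 => x; rewrite indicE; case: (_ \in _); rewrite ?normr1 ?normr0.
apply/andP; split.
  pose a : R := (k%:R + 8^-1) / kappa%:R; pose b : R := (k%:R + 4^-1) / kappa%:R.
  have -> : bump_min / kappa%:R = \int[U]_x ((bump_min * 8) * \1_(`[a, b]%classic : set (measurableTypeR R)) x).
    rewrite bmeas_RintegralZ// unit_lebesgue_itv.
    - by rewrite /a /b -mulrBl (_ : _ + _ - _ = 8^-1 :> R) ?mulrA ?mulfK//; lra.
    - by rewrite divr_ge0//; lra.
    - by rewrite ler_pM2r ?invr_gt0//; lra.
    - by rewrite ler_pdivrMr// mul1r; lra.
  apply: bmeas_le_Rintegral => //; first exact: bmeasZ.
  move=> x; rewrite indicE; have [|_] := boolP (x \in _); last by rewrite mulr0 -expr2 sqr_ge0.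
  rewrite inE/= in_itv/= mulr1 -expr2 (@ler_pdivrMr R)// (@ler_pdivlMr R)// => xab.
  by rewrite /bump_min mulfVK// bump0_ge//; lra.
have -> : kappa%:R^-1 = \int[U]_x \1_(`[k%:R / kappa%:R, (k%:R + 1) / kappa%:R]%classic : set (measurableTypeR R)) x.
  rewrite unit_lebesgue_itv; first by rewrite -mulrBl addrAC subrr add0r mul1r.
  - by rewrite divr_ge0.
  - by rewrite ler_pM2r ?invr_gt0//; lra.
  - by rewrite ler_pdivrMr// mul1r.
apply: bmeas_le_Rintegral => // x.
rewrite indicE; case: (boolP (x \in _)) => [_|]; last first.
  rewrite notin_setE/= in_itv/= (@ler_pdivrMr R)// (@ler_pdivlMr R)// => /negP xo.
  rewrite /cell_bump1 bump_out ?mul0r//; first exact: ltnW.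
  by apply: contraNN xo => /andP[x1 x2]; apply/andP; split; lra.
rewrite -expr2 -real_normK ?num_real// expr_le1//; apply: bump0_le1; exact: ltnW.
Qed.

End interval_integrals.

Section cube_integrals.
Context {R : realType} {d : nat}.
Variables (K kappa : nat).
Hypotheses (K2 : (1 < K)%N) (kappa0 : (0 < kappa)%N) (d0 : (0 < d)%N).
Local Notation cell := {ffun 'I_d -> 'I_kappa}.
Local Notation P0 := (@cube_lebesgue R d).

Definition cell_obs (j : cell) (t : obs d) : R :=
  cell_bump K (fun=> 0%N) j (row_of_obs t).

Lemma cell_obsE j t : cell_obs j t = \prod_i cell_bump1 K (j i) (tnth t i).
Proof.
by rewrite /cell_obs /cell_bump; apply: eq_bigr => i _; rewrite mxE.
Qed.

Lemma bmeas_cell_obs j : bmeas (cell_obs j).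
Proof.
rewrite (_ : cell_obs j = fun t => \prod_i cell_bump1 K (j i) (tnth t i)); last first.
  by apply/funext => t; exact: cell_obsE.
apply: bmeas_prod => i.
exact: (bmeas_comp (bmeas_cell_bump1 K2 (j i)) (measurable_tnth i)).
Qed.

Lemma Rintegral_cell_obs j : \int[P0]_t cell_obs j t = 0.
Proof.
under eq_Rintegral do rewrite cell_obsE.
rewrite /cube_lebesgue (Rintegral_prob_pow _ (fun i => bmeas_cell_bump1 K2 (j i))).
by rewrite (bigD1 (Ordinal d0))//= Rintegral_cell_bump1// mul0r.
Qed.

Lemma Rintegral_cell_obsM j l : \int[P0]_t (cell_obs j t * cell_obs l t) =
  \prod_i \int[unit_lebesgue]_x (cell_bump1 K (j i) x * cell_bump1 K (l i) x : R).
Proof.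
under eq_Rintegral do rewrite !cell_obsE -big_split/=.
exact: (Rintegral_prob_pow _
  (fun i => bmeasM (bmeas_cell_bump1 K2 (j i)) (bmeas_cell_bump1 K2 (l i)))).
Qed.

(** Distinct cells differ in some coordinate, where the bumps have disjoint
supports. *)
Lemma Rintegral_cell_obs_orth j l : j != l ->
  \int[P0]_t (cell_obs j t * cell_obs l t) = 0.
Proof.
move=> jl; rewrite Rintegral_cell_obsM.
have [i ji] : exists i, j i != l i.
  apply: contrapT => h; move/eqP: jl; apply; apply/ffunP => i.
  by apply/eqP; apply: contrapT => ji; apply: h; exists i; apply/negP.
rewrite (bigD1 i)//=; under eq_Rintegral do rewrite cell_bump1_disjoint//.
by rewrite Rintegral_cst1 mul0r.
Qed.

Definition cell_energy (j : cell) : R := \int[P0]_t (cell_obs j t * cell_obs j t).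

Lemma cell_energy_itv j :
  (bump_min K / kappa%:R) ^+ d <= cell_energy j <= (kappa%:R^-1) ^+ d.
Proof.
rewrite /cell_energy Rintegral_cell_obsM.
have E (u : R) : u ^+ d = \prod_(i < d) u by rewrite prodr_const card_ord.
have b0 : 0 <= bump_min K / kappa%:R :> R.
  by rewrite divr_ge0// /bump_min divr_ge0// sqr_ge0.
have H i := @Rintegral_cell_bump1_sqr R K kappa K2 kappa0 (j i).
rewrite !E; apply/andP; split; apply: ler_prod => i _.
  by rewrite b0; case/andP: (H i).
by have /andP[h1 h2] := H i; rewrite h2 (le_trans b0).
Qed.

Definition perturbed (rho : R) (eps : cell -> R) (x : 'rV[R]_d) : R :=
  1 + rho * perturbation K (fun=> 0%N) eps x.

Lemma perturbed_obsE rho eps t :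
  perturbed rho eps (row_of_obs t) = 1 + rho * \sum_j eps j * cell_obs j t.
Proof. by []. Qed.

Let bmeas_sum_cells (eps : cell -> R) :
  bmeas (fun t : obs d => \sum_j eps j * cell_obs j t).
Proof. by apply: bmeas_sum => j; apply: bmeasZ; exact: bmeas_cell_obs. Qed.

Lemma bmeas_perturbed rho eps :
  bmeas (fun t : obs d => perturbed rho eps (row_of_obs t)).
Proof. by apply: bmeasD (bmeas_cst 1) _; apply: bmeasZ; exact: bmeas_sum_cells. Qed.

Let Rintegral_sum_cells (eps : cell -> R) :
  \int[P0]_t (\sum_j eps j * cell_obs j t) = 0.
Proof.
rewrite bmeas_Rintegral_sum; last by move=> j; apply: bmeasZ; exact: bmeas_cell_obs.
apply: big1 => j _; rewrite bmeas_RintegralZ ?Rintegral_cell_obs ?mulr0//.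
exact: bmeas_cell_obs.
Qed.

Lemma Rintegral_perturbed rho eps :
  \int[P0]_t perturbed rho eps (row_of_obs t) = 1.
Proof.
have bS := bmeas_sum_cells eps.
rewrite (bmeas_RintegralD _ (bmeas_cst 1) (bmeasZ rho bS)).
by rewrite Rintegral_cst1 bmeas_RintegralZ// Rintegral_sum_cells mulr0 addr0.
Qed.

Lemma Rintegral_sum_cellsM (eps eps' : cell -> R) :
  \int[P0]_t ((\sum_j eps j * cell_obs j t) * (\sum_j eps' j * cell_obs j t)) =
  \sum_j eps j * eps' j * cell_energy j.
Proof.
have bc j l : bmeas (fun t : obs d => cell_obs j t * cell_obs l t).
  by apply: bmeasM; exact: bmeas_cell_obs.
transitivity (\int[P0]_t (\sum_j \sum_l (eps j * eps' l) * (cell_obs j t * cell_obs l t))).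
  apply: eq_Rintegral => t _; rewrite mulr_suml; apply: eq_bigr => j _.
  by rewrite mulr_sumr; apply: eq_bigr => l _; rewrite mulrACA.
rewrite bmeas_Rintegral_sum; last by move=> j; apply: bmeas_sum => l; exact: bmeasZ.
apply: eq_bigr => j _; rewrite bmeas_Rintegral_sum; last by move=> l; exact: bmeasZ.
rewrite (bigD1 j)//= big1 ?addr0; last first.
  move=> l lj; rewrite bmeas_RintegralZ// Rintegral_cell_obs_orth ?mulr0//.
  by rewrite eq_sym.
by rewrite bmeas_RintegralZ.
Qed.

(** The linear terms vanish as the bumps have mean zero, and the quadratic one is
diagonal as they are orthogonal. *)
Lemma Rintegral_perturbedM rho eps eps' :
  \int[P0]_t (perturbed rho eps (row_of_obs t) * perturbed rho eps' (row_of_obs t))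
  = 1 + \sum_j (rho ^+ 2 * cell_energy j) * (eps j * eps' j).
Proof.
pose S e (t : obs d) := \sum_j e j * cell_obs j t.
have bS e : bmeas (S e) by exact: bmeas_sum_cells.
transitivity (\int[P0]_t (1 + (rho * S eps t + (rho * S eps' t +
    rho ^+ 2 * (S eps t * S eps' t))))).
  by apply: eq_Rintegral => t _; rewrite !perturbed_obsE -!/(S _ t); ring.
have b3 : bmeas (fun t => rho ^+ 2 * (S eps t * S eps' t)) by apply: bmeasZ; exact: bmeasM.
rewrite bmeas_RintegralD ?Rintegral_cst1; [|exact: bmeas_cst|]; last first.
  by do 2! (apply: bmeasD; first exact: bmeasZ).
rewrite bmeas_RintegralD; [|exact: bmeasZ|by apply: bmeasD => //; exact: bmeasZ].
rewrite bmeas_RintegralD; [|exact: bmeasZ|by []].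
rewrite !bmeas_RintegralZ//; last exact: bmeasM.
rewrite !Rintegral_sum_cells !mulr0 !add0r Rintegral_sum_cellsM mulr_sumr.
by congr (_ + _); apply: eq_bigr => j _; ring.
Qed.

End cube_integrals.

(** * Densities on the cube *)

Section densities.
Context {R : realType} {d : nat}.
Local Notation P0 := (@cube_lebesgue R d).

Lemma cube_lebesgue_cube : P0 (obs_cube d) = 1%E.
Proof.
have m01 : measurable (`[0, 1]%classic : set (measurableTypeR R)) by [].
rewrite (_ : obs_cube d = [set t | forall i, (`[0, 1]%classic : set (measurableTypeR R)) (tnth t i)]); last first.
  by apply/seteqP; split => t h i; have := h i; rewrite /= in_itv/= mxE.
apply: (eq_trans (prob_pow_box unit_lebesgue (fun i : 'I_d => m01))).
rewrite big1// => i _; rewrite /= /unit_lebesgue /mrestr setIid.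
by rewrite -[LHS]/(lebesgue_measure [set` `[0, 1]]) lebesgue_measure_itv/= lte01 oppr0 adde0.
Qed.

Lemma integral_cube (h : obs d -> \bar R) : measurable_fun setT h ->
  (forall t, 0 <= h t)%E ->
  (\int[P0]_(t in obs_cube d) h t = \int[P0]_t h t)%E.
Proof.
move=> mh h0.
have mC := @measurable_obs_cube R d.
rewrite [RHS](@ge0_negligible_integral _ _ _ _ _ (~` obs_cube d))//.
- by rewrite setTD setCK.
- exact: measurableC.
- by rewrite [LHS]probability_setC// cube_lebesgue_cube subee.
Qed.

Lemma exists_density (f : 'rV[R]_d -> R) :
  measurable_fun setT (f \o row_of_obs) -> (forall x, 0 <= f x) ->
  (\int[P0]_t (f (row_of_obs t))%:E = 1)%E ->
  exists g : density d, density_fun g = f.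
Proof.
move=> mf f0 f1.
have mc : measurable_fun (obs_cube d) (f \o row_of_obs) by exact: measurable_funTS.
have c1 : (\int[P0]_(t in obs_cube d) (f (row_of_obs t))%:E = 1)%E.
  by rewrite integral_cube//; [exact/measurable_EFinP|move=> t; rewrite lee_fin].
by exists (Density mc (fun x _ => f0 x) c1).
Qed.

(** The complement of the cube is negligible, so that integrating the density
over a set or over its part in the cube gives the same value. *)
Lemma law_has_density (f : density d) :
  measurable_fun setT (f \o row_of_obs) -> (forall x, 0 <= f x) ->
  has_density (law f) P0 (f \o row_of_obs).
Proof.
move=> mf f0; split=> [//|t|h mh h0]; first exact: f0.
apply: ge0_integral_density => //; [by move=> t; exact: f0|move=> A mA].
rewrite -[LHS]/(\int[P0]_(t in A `&` obs_cube d) (f (row_of_obs t))%:E)%E.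
rewrite setIC integral_mkcondr integral_cube -?integral_mkcond//.
- have mE : measurable_fun setT (EFin \o (f \o row_of_obs)) by exact/measurable_EFinP.
  exact: (measurable_restrictT _ mA).1 (measurable_funTS mE).
- by move=> t; rewrite patchE; case: ifPn => // _; rewrite lee_fin.
Qed.

Lemma L2dist_ge (f g : density d) (r : R) : 0 <= r ->
  bmeas (fun t : obs d => f (row_of_obs t) - g (row_of_obs t)) ->
  r ^+ 2 <= \int[P0]_t ((f (row_of_obs t) - g (row_of_obs t)) ^+ 2) ->
  (r%:E <= L2dist f g)%E.
Proof.
move=> r0 bfg rle.
have b2 : bmeas (fun t : obs d => (f (row_of_obs t) - g (row_of_obs t)) ^+ 2).
  by under eq_fun do rewrite expr2; exact: bmeasM.
rewrite /L2dist unlock /=.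
have -> : (\int[P0]_t (`|((fun t => (f (row_of_obs t) - g (row_of_obs t))%:E) \_ (obs_cube d)) t| `^ 2)
   = (\int[P0]_t ((f (row_of_obs t) - g (row_of_obs t)) ^+ 2))%:E)%E.
  have mb2 : measurable_fun setT (fun t : obs d => ((f (row_of_obs t) - g (row_of_obs t)) ^+ 2)%:E).
    by apply/measurable_EFinP; case: b2.
  rewrite EFin_Rintegral// -(integral_cube mb2); last by move=> t; rewrite lee_fin sqr_ge0.
  rewrite [RHS]integral_mkcond; apply: eq_integral => t _.
  rewrite !patchE; case: ifPn => _.
    by rewrite /= -[LHS]/((`|_| `^ 2)%:E) powR_mulrn// real_normK// num_real.
  by rewrite -[LHS]/((`|0 : R| `^ 2)%:E) normr0 powR0.
rewrite poweR_EFin lee_fin powR12_sqrt ?(le_trans _ rle) ?sqr_ge0//.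
by rewrite -[leLHS](ger0_norm r0) -sqrtr_sqr ler_wsqrtr.
Qed.

End densities.

(** * Lower bound on the minimax risk by a second moment *)

Section mixture_bound.
Context {R : realType} {d : nat}.
Local Notation P0 := (@cube_lebesgue R d).
Variables (m n : nat).
Local Notation Q := (prob_pow P0 m \x prob_pow P0 n)%E.

Definition likelihood (u v : @obs R d -> R) (z : @data R m n d) : R :=
  (\prod_i u (tnth z.1 i)) * (\prod_i v (tnth z.2 i)).

Lemma bmeas_prod_tnth k (u : @obs R d -> R) : bmeas u ->
  bmeas (fun t : k.-tuple (obs d) => \prod_i u (tnth t i)).
Proof.
move=> bu; apply: bmeas_prod => i; exact: (bmeas_comp bu (measurable_tnth i)).
Qed.

Lemma bmeas_likelihood u v : bmeas u -> bmeas v -> bmeas (likelihood u v).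
Proof.
move=> bu bv; apply: bmeasM.
  exact: (bmeas_comp (bmeas_prod_tnth _ bu) measurable_fst).
exact: (bmeas_comp (bmeas_prod_tnth _ bv) measurable_snd).
Qed.

Lemma Rintegral_likelihood u v : bmeas u -> bmeas v ->
  \int[Q]_z likelihood u v z = (\int[P0]_t u t) ^+ m * (\int[P0]_t v t) ^+ n.
Proof.
move=> bu bv; rewrite (Rintegral_product _ _ (bmeas_prod_tnth m bu) (bmeas_prod_tnth n bv)).
rewrite (Rintegral_prob_pow P0 (fun=> bu)) (Rintegral_prob_pow P0 (fun=> bv)).
by rewrite !prodr_const !card_ord.
Qed.

Lemma likelihoodM u v u' v' z : likelihood u v z * likelihood u' v' z =
  likelihood (fun t => u t * u' t) (fun t => v t * v' t) z.
Proof. by rewrite /likelihood mulrACA -!big_split. Qed.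

Lemma two_sample_expectationE (f g : density d) (phi : @data R m n d -> R) :
  bmeas (f \o row_of_obs) -> (forall x, 0 <= f x) ->
  bmeas (g \o row_of_obs) -> (forall x, 0 <= g x) ->
  bmeas phi -> (forall z, 0 <= phi z) ->
  two_sample_expectation f g phi =
    (\int[Q]_z (phi z * likelihood (f \o row_of_obs) (g \o row_of_obs) z))%:E.
Proof.
move=> bf f0 bg g0 bphi phi0.
have Df := has_density_prob_pow m (law_has_density bf.1 f0).
have Dg := has_density_prob_pow n (law_has_density bg.1 g0).
have [_ _ D] := has_density_product Df Dg.
have bl := bmeasM bphi (bmeas_likelihood bf bg).
rewrite /two_sample_expectation unlock EFin_Rintegral// D//.
  by apply/measurable_EFinP; case: bphi.
Qed.

(** The null is the uniform density for both samples, so the likelihood of an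
alternative is its density. By independence, the second moment of the likelihood
of the mixture is an average of products of powers of the scalar products
between densities. *)
Lemma minimax_risk_ge (H : set ('rV[R]_d -> R)) (eps : R) (f0 : density d)
    (I : finType) (f g : I -> density d) :
  density_fun f0 = cst 1 -> H f0 -> (0 < #|I|)%N ->
  (forall i, [/\ H (f i), H (g i) & (eps%:E <= L2dist (f i) (g i))%E]) ->
  (forall i, [/\ bmeas (f i \o row_of_obs), (forall x, 0 <= f i x) &
    \int[P0]_t f i (row_of_obs t) = 1]) ->
  (forall i, [/\ bmeas (g i \o row_of_obs), (forall x, 0 <= g i x) &
    \int[P0]_t g i (row_of_obs t) = 1]) ->
  \sum_i \sum_j (\int[P0]_t (f i (row_of_obs t) * f j (row_of_obs t))) ^+ m *
    (\int[P0]_t (g i (row_of_obs t) * g j (row_of_obs t))) ^+ n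
    <= 5 / 4 * #|I|%:R ^+ 2 ->
  ((1 / 2)%:E <= minimax_risk m n H eps)%E.
Proof.
move=> f01 Hf0 I0 HI fP gP chi2; apply: le_ereal_inf_tmp => _ [phi [mphi phi01] <-].
have bphi : bmeas phi.
  by split=> //; exists 1 => z; have /andP[p0 p1] := phi01 z; rewrite ger0_norm.
have bphi1 : bmeas (fun z => 1 - phi z) by exact: bmeasB (bmeas_cst 1) bphi.
pose Z i := likelihood (f i \o row_of_obs) (g i \o row_of_obs).
have bZ i : bmeas (Z i).
  by have [? _ _] := fP i; have [? _ _] := gP i; exact: bmeas_likelihood.
have Z1 i : \int[Q]_z Z i z = 1.
  have [? _ fi] := fP i; have [? _ gi] := gP i.
  by rewrite Rintegral_likelihood//= fi gi !expr1n mulr1.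
have Z2 : \sum_i \sum_j \int[Q]_z (Z i z * Z j z) <= 5 / 4 * #|I|%:R ^+ 2.
  apply: le_trans chi2; rewrite le_eqVlt; apply/predU1P; left.
  apply: eq_bigr => i _; apply: eq_bigr => j _.
  under eq_Rintegral do rewrite likelihoodM.
  have [? _ _] := fP i; have [? _ _] := gP i; have [? _ _] := fP j; have [? _ _] := gP j.
  by rewrite Rintegral_likelihood//; exact: bmeasM.
have [i hi] := exists_large_error I0 bZ Z1 Z2 bphi phi01.
have E0 : two_sample_expectation f0 f0 phi = (\int[Q]_z phi z)%:E.
  have b1 : bmeas (f0 \o row_of_obs) by rewrite f01; exact: bmeas_cst.
  have p1 x : 0 <= f0 x by rewrite f01 ler01.
  rewrite two_sample_expectationE//; last by move=> z; case/andP: (phi01 z).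
  congr EFin; apply: eq_Rintegral => z _.
  rewrite /likelihood f01.
  by rewrite !big1 ?mulr1.
have Ei : two_sample_expectation (f i) (g i) (fun z => 1 - phi z) =
    (\int[Q]_z ((1 - phi z) * Z i z))%:E.
  have [? ? _] := fP i; have [? ? _] := gP i.
  rewrite two_sample_expectationE// => z.
  by rewrite subr_ge0; case/andP: (phi01 z).
apply: (@le_trans _ _ (two_sample_expectation f0 f0 phi +
    two_sample_expectation (f i) (g i) (fun z => 1 - phi z)%R)%E).
  by rewrite E0 Ei lee_fin.
apply: leeD.
  by apply: ereal_sup_ubound; exists f0.
by apply: ereal_sup_ubound; exists (f i, g i) => //; exact: HI.
Qed.

End mixture_bound.

(** * Choice of the mesh and of the amplitude *)

Section rate.
Context {R : realType}.

(** [kappa] is one more than the integer part of [N `^ (2 / (4 s + d))], hence at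
most twice this number, which is at least [1]. The first inequality bounds the second moment, the
second one gives the rate. *)
Lemma exists_bandwidth (s : R) (d N : nat) : 0 < s -> (0 < N)%N ->
  exists kappa : nat, [/\ (0 < kappa)%N,
    N%:R ^+ 2 <= (kappa%:R `^ s) ^+ 4 * kappa%:R ^+ d &
    2 `^ (- s) * N%:R `^ (- (2 * s / (4 * s + d%:R))) <= kappa%:R `^ (- s)].
Proof.
move=> s0 N0; have NR : 1 <= N%:R :> R by rewrite ler1n.
have q0 : 0 < 4 * s + d%:R by rewrite ltr_pwDl// mulr_gt0.
pose x : R := N%:R `^ (2 / (4 * s + d%:R)).
have x1 : 1 <= x.
  by rewrite -(powRr0 N%:R) ler_powR// divr_ge0// ltW.
have xge0 : 0 <= x by exact: le_trans x1.
pose k := (Num.truncn x).+1.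
have xk : x <= k%:R by rewrite ltW// truncnS_gt.
have kx : k%:R <= 2 * x.
  have xt : (Num.truncn x)%:R <= x by rewrite truncn_le.
  by rewrite /k -natr1; lra.
exists k; split=> //.
  rewrite -powR_mulrn// -powRrM -powR_mulrn// -powRD; last by rewrite pnatr_eq0 implybT.
  apply: (@le_trans _ _ (x `^ (4 * s + d%:R))).
    by rewrite /x -powRrM mulfVK ?gt_eqF// powR_mulrn.
  by rewrite [X in _ `^ (X + _)]mulrC ge0_ler_powR// ?nnegrE// ltW.
have -> : N%:R `^ (- (2 * s / (4 * s + d%:R))) = x `^ (- s).
  by rewrite /x -powRrM; congr (_ `^ _); field; rewrite gt_eqF.
rewrite -powRM// !powRN lef_pV2 ?posrE ?powR_gt0 ?mulr_gt0 ?(lt_le_trans ltr01 x1)//.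
by rewrite ge0_ler_powR// ?nnegrE ?mulr_ge0// ltW.
Qed.

End rate.

Section lower_bound.
Context {R : realType} {d : nat}.
Variables (K kappa : nat).
Hypotheses (K2 : (1 < K)%N) (kappa0 : (0 < kappa)%N) (d0 : (0 < d)%N).
Local Notation cell := {ffun 'I_d -> 'I_kappa}.
Local Notation P0 := (@cube_lebesgue R d).
Local Notation pert rho eta :=
  (perturbed K rho (fun j : cell => rsign ((eta : {ffun cell -> bool}) j))).

Let rsign1 b : `|rsign b : R| = 1.
Proof. by rewrite normrX normrN1 expr1n. Qed.

Lemma rsign_sqr b : rsign b * rsign b = 1 :> R.
Proof. by case: b; rewrite /rsign ?expr0 ?expr1 ?mulr1// mulrNN mulr1. Qed.

Lemma perturbation_le1 (eps : cell -> R) (x : 'rV[R]_d) : (forall j, `|eps j| <= 1) ->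
  `|perturbation K (fun=> 0%N) eps x| <= 1.
Proof.
move=> e1; rewrite -(expr1n R d); apply: perturbation_bound => // [i z|i].
  by apply: bump0_le1; exact: ltnW.
exact: ltnW.
Qed.

Lemma perturbed_ge0 (rho : R) (eta : {ffun cell -> bool}) x : 0 <= rho <= 1 -> 0 <= pert rho eta x.
Proof.
move=> /andP[r0 r1]; rewrite /perturbed.
have := @perturbation_le1 (fun j => rsign (eta j)) x.
rewrite ler_norml => /(_ (fun j => eq_ind_r (fun u => u <= 1) (lexx 1) (rsign1 _))) /andP[p1 p2].
nra.
Qed.

(** Scalar products of densities are nonnegative, so that [1 + u <= expR u] may
be raised to the power [N]. *)
Lemma chi2_mixture (rho : R) (N : nat) : 0 <= rho <= 1 ->
  \sum_(j : cell) (N%:R * (rho ^+ 2 * cell_energy K j)) ^+ 2 <= 1 / 5 ->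
  \sum_(eta : {ffun cell -> bool}) \sum_(eta' : {ffun cell -> bool})
    (\int[P0]_t (pert rho eta (row_of_obs t) * pert rho eta' (row_of_obs t))) ^+ N
  <= 5 / 4 * #|{ffun cell -> bool}|%:R ^+ 2.
Proof.
move=> r01 x5; set x := fun j : cell => N%:R * (rho ^+ 2 * cell_energy K j).
apply: (@le_trans _ _ (\sum_(eta : {ffun cell -> bool}) \sum_(eta' : {ffun cell -> bool})
    expR (\sum_j x j * (rsign (eta j) * rsign (eta' j))))).
  apply: ler_sum => eta _; apply: ler_sum => eta' _.
  under [in leRHS]eq_bigr do rewrite -mulrA.
  rewrite -mulr_sumr expRM_natl lerXn2r ?nnegrE ?expR_ge0//.
    by apply: Rintegral_ge0 => t _; rewrite mulr_ge0// perturbed_ge0.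
  by rewrite Rintegral_perturbedM//; exact: expR_ge1Dx.
apply: (le_trans (sum_rademacher _)); first by apply: le_lt_trans x5 _; lra.
have D0 : 0 < 1 - \sum_j x j ^+ 2 by lra.
by rewrite mulrC ler_wpM2r ?exprn_ge0// -[leRHS]invrK lef_pV2 ?posrE ?invr_gt0//; lra.
Qed.

(** [K] exceeds [sfloor s] by enough for the derivatives of order [sfloor s] to be
themselves differentiable, hence Lipschitz. *)
Lemma hoelder_class_perturbed (s L M rho : R) (eps : cell -> R) :
  0 < s -> 0 <= M -> 0 <= rho -> K = (sfloor s + 3)%N ->
  (forall a z, (a < K)%N -> `|bump K a z| <= M) -> (forall j, `|eps j| <= 1) ->
  1 + rho <= L ->
  d%:R ^+ sfloor s * (rho * kappa%:R `^ s * (2 * d%:R * M ^+ d)) <= L ->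
  hoelder_class s d L (perturbed K rho eps).
Proof.
move=> s0 M0 rho0 KE hM e1 rL BL.
apply: (hoelder_class_tower _ BL) => //.
- by rewrite !mulr_ge0// ?powR_ge0// exprn_ge0.
- move=> x _; rewrite (le_trans _ rL)// (le_trans (ler_normD _ _))// normr1 lerD2l.
  by rewrite normrM ger0_norm// ler_piMr// perturbation_le1.
- have sK : (sfloor s + 2 <= K)%N by rewrite KE leq_add2l.
  have a0 : (\sum_(i < d) 0 + sfloor s)%N = sfloor s by rewrite big1.
  have := perturbation_tower s0 M0 rho0 kappa0 d0 hM sK e1 a0.
  move=> /(hoelder_tower_addc 1); congr hoelder_tower; apply/funext => x.
  by rewrite /perturbed big1// expr0 mulr1.
Qed.

Lemma sum_cell_energy_ge : bump_min K ^+ d <= \sum_(j : cell) (cell_energy K j : R).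
Proof.
apply: (@le_trans _ _ (\sum_(j : cell) (bump_min K / kappa%:R) ^+ d)).
  rewrite sumr_const card_ffun !card_ord -[leRHS]mulr_natr natrX -exprMn.
  by rewrite divfK// pnatr_eq0 -lt0n.
by apply: ler_sum => j _; have /andP[] := @cell_energy_itv R d K kappa K2 kappa0 j.
Qed.

(** There are [kappa ^+ d] cells, each of energy at most [kappa ^- d]. *)
Lemma sum_cell_energy_sqr_le (y : R) :
  \sum_(j : cell) (y * cell_energy K j) ^+ 2 <= y ^+ 2 * (kappa%:R^-1) ^+ d.
Proof.
have k0 : kappa%:R != 0 :> R by rewrite pnatr_eq0 -lt0n.
apply: (@le_trans _ _ (\sum_(j : cell) y ^+ 2 * (kappa%:R^-1 ^+ d) ^+ 2)).
  apply: ler_sum => j _; rewrite exprMn ler_wpM2l ?sqr_ge0//.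
  have /andP[h1 h2] := @cell_energy_itv R d K kappa K2 kappa0 j.
  have b0 : 0 <= (bump_min K / kappa%:R) ^+ d :> R.
    by rewrite exprn_ge0// divr_ge0// divr_ge0// sqr_ge0.
  by rewrite lerXn2r ?nnegrE// ?exprn_ge0// ?invr_ge0// (le_trans b0).
rewrite -mulr_sumr ler_wpM2l ?sqr_ge0// sumr_const card_ffun !card_ord.
rewrite -[leLHS]mulr_natr natrX expr2 -mulrA -exprMn mulVf// expr1n mulr1.
exact: lexx.
Qed.

Lemma perturbed_distance (rho : R) (eta : {ffun cell -> bool}) :
  (rho * Num.sqrt (bump_min K ^+ d)) ^+ 2 <=
  \int[P0]_t ((pert rho eta (row_of_obs t) - 1) ^+ 2).
Proof.
pose S (t : @obs R d) : R := \sum_j rsign (eta j) * cell_obs K j t.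
have bS : bmeas S by apply: bmeas_sum => j; apply: bmeasZ; exact: bmeas_cell_obs.
have -> : \int[P0]_t ((pert rho eta (row_of_obs t) - 1) ^+ 2) =
    \int[P0]_t (rho ^+ 2 * (S t * S t)).
  by apply: eq_Rintegral => t _; rewrite perturbed_obsE -/(S t); ring.
rewrite bmeas_RintegralZ; last exact: bmeasM.
rewrite Rintegral_sum_cellsM// exprMn sqr_sqrtr; last first.
  by rewrite exprn_ge0// divr_ge0// sqr_ge0.
rewrite ler_wpM2l ?sqr_ge0//; under eq_bigr do rewrite rsign_sqr mul1r.
exact: sum_cell_energy_ge.
Qed.

End lower_bound.

Lemma exists_bump_bound (R : realType) (K : nat) :
  exists2 M : R, 0 <= M & forall a z, (a < K)%N -> `|bump K a z| <= M.
Proof.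
have /choice[F FP] : forall a : 'I_K, exists M : R,
    0 <= M /\ forall x, `|bump K a x| <= M.
  by move=> a; have [M M0 hM] := @bump_bounded R K a (ltn_ord a); exists M.
exists (\sum_a F a); first by apply: sumr_ge0 => a _; exact: (FP a).1.
move=> a z aK; apply: le_trans ((FP (Ordinal aK)).2 z) _.
rewrite (bigD1 (Ordinal aK))//= lerDl; apply: sumr_ge0 => b _; exact: (FP b).1.
Qed.

(** * The lower bound *)

Theorem theorem3 (R : realType) (s : R) (d : nat) (L : R)
    (s_gt0 : 0 < s) (d_gt0 : (0 < d)%N) (L_gt1 : 1 < L) :
  exists c : R, 0 < c /\
    forall (m n : nat) (eps : R), (0 < m)%N -> (0 < n)%N -> 0 < eps ->
      eps <= c * (minn m n)%:R `^ (- (2 * s / (4 * s + d%:R))) ->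
      ((1 / 2)%:E <= minimax_risk m n (hoelder_class s d L) eps)%E.
Proof.
pose K := (sfloor s + 3)%N.
have K2 : (1 < K)%N by rewrite /K addn3.
have [M M0 hM] := exists_bump_bound R K.
pose B : R := d%:R ^+ sfloor s * (2 * d%:R * M ^+ d).
have B0 : 0 <= B by rewrite !mulr_ge0 ?exprn_ge0.
(* The three bounds give, in this order, a small second moment, the sup bound on
the densities, and the bounds on their derivatives. *)
pose c0 : R := Num.min 2^-1 (Num.min (L - 1) (1 + B)^-1).
have c0_gt0 : 0 < c0.
  by rewrite !lt_min invr_gt0 ltr0n subr_gt0 L_gt1 invr_gt0 ltr_pwDl.
have c0_half : c0 <= 2^-1 by rewrite ge_min lexx.
have c0L : 1 + c0 <= L.
  have : c0 <= L - 1 by rewrite !ge_min lexx orbT.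
  lra.
have c0B : c0 * B <= L.
  have : c0 <= (1 + B)^-1 by rewrite !ge_min lexx !orbT.
  move=> /(ler_wpM2r B0)/le_trans; apply.
  by rewrite mulrC ler_pdivrMr; nra.
pose beta : R := Num.sqrt (bump_min K ^+ d).
have bmin0 : 0 < bump_min K :> R by rewrite divr_gt0// exprn_gt0// mulr_gt0// exprn_gt0.
have beta0 : 0 < beta by rewrite sqrtr_gt0 exprn_gt0.
(* The factor [2 `^ (- s)] pays for the integrality of the number of cells on an axis. *)
exists (c0 * 2 `^ (- s) * beta); split.
  by rewrite !mulr_gt0// powR_gt0.
move=> m n eps m0 n0 eps0 eps_le.
pose N := minn m n.
have N0 : (0 < N)%N by rewrite leq_min m0.
have [kappa [k0 kN kS]] := exists_bandwidth d s_gt0 N0.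
have kR : 1 <= kappa%:R :> R by rewrite ler1n.
have ks0 : 0 < kappa%:R `^ s by rewrite powR_gt0; lra.
pose rho := c0 * kappa%:R `^ (- s).
have rhoE : rho * kappa%:R `^ s = c0 by rewrite /rho powRN mulfVK ?gt_eqF.
have rho0 : 0 < rho by rewrite mulr_gt0// powR_gt0; lra.
have rho_le : rho <= c0.
  by rewrite -rhoE ler_pMr// -[leLHS](powRr0 kappa%:R) ler_powR// ltW.
have rho01 : 0 <= rho <= 1 by rewrite ltW//=; lra.
have eps_rho : eps <= rho * beta.
  by rewrite (le_trans eps_le)// /rho mulrAC ler_pM2r// -[leLHS]mulrA ler_pM2l//; exact: kS.
pose cell := {ffun 'I_d -> 'I_kappa}.
pose sgn (eta : {ffun cell -> bool}) (j : cell) : R := rsign (eta j).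
have sgn1 eta j : `|sgn eta j| <= 1 by rewrite normrX normrN1 expr1n.
pose w eta := perturbed K rho (sgn eta).
have w0 eta x : 0 <= w eta x by exact: perturbed_ge0.
have wb eta : bmeas (w eta \o row_of_obs) by exact: bmeas_perturbed.
have w1 eta : \int[cube_lebesgue d]_t w eta (row_of_obs t) = 1.
  exact: Rintegral_perturbed.
have Hw eta : hoelder_class s d L (w eta).
  apply: (hoelder_class_perturbed K2 k0 d_gt0 s_gt0 M0 (ltW rho0) (erefl K) hM) => //.
    lra.
  by rewrite rhoE mulrCA; exact: c0B.
have H1 : hoelder_class s d L (cst 1).
  have -> : cst 1 = perturbed K 0 (sgn [ffun=> true]).
    by apply/funext => x; rewrite /perturbed mul0r addr0.
  apply: (hoelder_class_perturbed K2 k0 d_gt0 s_gt0 M0 (lexx 0) (erefl K) hM) => //.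
    by rewrite addr0 ltW.
  by rewrite !mul0r mulr0 (le_trans ler01)// ltW.
have /choice[f fE] : forall eta, exists g : density d, density_fun g = w eta.
  move=> eta; apply: exists_density; [by case: (wb eta)|exact: w0|].
  by rewrite -(EFin_Rintegral _ (wb eta)) w1.
have [f0 f0E] : exists g : density d, density_fun g = cst (1 : R).
  apply: exists_density => [|x|]; [exact: measurable_cst|exact: ler01|].
  by rewrite -(EFin_Rintegral _ (bmeas_cst 1)) Rintegral_cst1.
have chi2 : \sum_(j : cell) (N%:R * (rho ^+ 2 * cell_energy K j)) ^+ 2 <= 1 / 5.
  under eq_bigr do rewrite mulrA.
  apply: (le_trans (sum_cell_energy_sqr_le K2 k0 (N%:R * rho ^+ 2))).
  rewrite exprVn /rho powRN; set P := kappa%:R `^ s in kN ks0 *.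
  set D := kappa%:R ^+ d in kN *.
  have D0 : 0 < D by rewrite exprn_gt0//; lra.
  have -> : (N%:R * (c0 / P) ^+ 2) ^+ 2 / D = c0 ^+ 4 * (N%:R ^+ 2 / (P ^+ 4 * D)).
    by field; rewrite !gt_eqF.
  have NP : N%:R ^+ 2 / (P ^+ 4 * D) <= 1.
    by rewrite ler_pdivrMr ?mul1r// mulr_gt0// exprn_gt0.
  have c4 : c0 ^+ 4 <= 2^-1 ^+ 4 by rewrite lerXn2r// nnegrE// ltW.
  rewrite (le_trans (ler_piMr _ NP))// ?exprn_ge0 ?ltW//.
  by rewrite (le_lt_trans c4)//; lra.
have I0 : (0 < #|{ffun cell -> bool}|)%N.
  by apply/card_gt0P; exists [ffun=> true].
have fP eta : [/\ bmeas (f eta \o row_of_obs), (forall x, 0 <= f eta x) &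
    \int[cube_lebesgue d]_t f eta (row_of_obs t) = 1].
  by rewrite !fE.
have f0P : [/\ bmeas (f0 \o row_of_obs), (forall x, 0 <= f0 x) &
    \int[cube_lebesgue d]_t f0 (row_of_obs t) = 1].
  by rewrite !f0E; split; [exact: bmeas_cst|move=> x; exact: ler01|exact: Rintegral_cst1].
have rb0 : 0 <= rho * beta by rewrite mulr_ge0// ltW.
have dist eta : (eps%:E <= L2dist (f eta) f0)%E /\ (eps%:E <= L2dist f0 (f eta))%E.
  split; apply: (@le_trans _ _ (rho * beta)%:E) => //; apply: L2dist_ge => //.
  - by rewrite fE f0E; exact: bmeasB (wb eta) (bmeas_cst 1).
  - by rewrite fE f0E; exact: perturbed_distance.
  - by rewrite fE f0E; exact: bmeasB (bmeas_cst 1) (wb eta).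
  - rewrite fE f0E; under eq_Rintegral do rewrite -sqrrN opprB.
    exact: perturbed_distance.
have f00 : \int[cube_lebesgue d]_t (f0 (row_of_obs t) * f0 (row_of_obs t)) = 1.
  by rewrite f0E; under eq_Rintegral do rewrite mulr1; exact: Rintegral_cst1.
(* The sample that carries the perturbation is the smaller one. *)
have [mn|nm] := leqP m n.
- apply: (@minimax_risk_ge _ _ m n _ _ f0 _ f (fun=> f0)) => //.
  + by rewrite f0E.
  + by move=> eta; split; [rewrite fE|rewrite f0E|exact: (dist eta).1].
  + move: (chi2_mixture K2 k0 d_gt0 rho01 chi2); rewrite /N (minn_idPl mn).
    apply: le_trans; rewrite le_eqVlt; apply/predU1P; left.
    by apply: eq_bigr => i _; apply: eq_bigr => j _; rewrite f00 expr1n mulr1 !fE.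
- apply: (@minimax_risk_ge _ _ m n _ _ f0 _ (fun=> f0) f) => //.
  + by rewrite f0E.
  + by move=> eta; split; [rewrite f0E|rewrite fE|exact: (dist eta).2].
  + move: (chi2_mixture K2 k0 d_gt0 rho01 chi2); rewrite /N (minn_idPr (ltnW nm)).
    apply: le_trans; rewrite le_eqVlt; apply/predU1P; left.
    by apply: eq_bigr => i _; apply: eq_bigr => j _; rewrite f00 expr1n mul1r !fE.
Qed.
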